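(* Let $n$ be odd. Then $KD(n)$ is self-dual, via the Kac algebra isomorphism $\psi:KD(n)\to\widehat{KD(n)}$ given on generators by $$\lambda(a)\mapsto n\Bigl(2\,\widehat{e^{n-1}_{1,1}}+\widehat{e^1_{2,2}}-\bigl(\widehat{e^1_{1,1}}+\widehat{e^{n-1}_{1,2}}+\widehat{e^{n-1}_{2,1}}\bigr)\Bigr),\qquad \lambda(b)\mapsto 4n\,\widehat{e_4}.$$
   Context: A finite-dimensional Kac algebra is a finite-dimensional $C^*$-algebra $K$ with a Hopf algebra structure $(\Delta,\varepsilon,S)$ for which $\Delta$ is a $*$-homomorphism; isomorphisms are $*$-algebra isomorphisms compatible with coproducts. The dual $\hat K$ is the dual vector space with product $(fg)(x)=(f\otimes g)(\Delta(x))$, coproduct dual to the product of $K$, and involution $f^*(x)=\overline{f(S(x)^* )}$. $K$ is self-dual if $K\cong\hat K$. $KD(n)$ ($n\ge1$): let $D_{2n}=\langle a,b\mid a^{2n}=b^2=1,\ ba=a^{-1}b\rangle$ (order $4n$), with canonical basis $\lambda(g)$ of $\mathbb{C}[D_{2n}]$, and $\Delta_s(\lambda(g))=\lambda(g)\otimes\lambda(g)$. Put $h_1=1,h_2=a^n,h_3=b,h_4=ba^n$, $\nu=-1+2\mathrm{i}$, and $\Omega=\sum_{i,j}c_{i,j}\lambda(h_i)\otimes\lambda(h_j)$ with $$(c_{i,j})=\frac18\begin{pmatrix}5&1&1&1\\1&1&\bar\nu&\nu\\1&\nu&1&\bar\nu\\1&\bar\nu&\nu&1\end{pmatrix}.$$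 $\Omega$ is unitary. $KD(n)$ is the $*$-algebra $\mathbb{C}[D_{2n}]$ with its usual counit and antipode and the coproduct $\Delta(x)=\Omega\Delta_s(x)\Omega^*$. Let $\epsilon=\mathrm{e}^{\mathrm{i}\pi/n}$ and, for integers $j$ (these are matrix units of the $2\times2$ blocks of $\mathbb{C}[D_{2n}]$ when $1\le j\le n-1$): $e^j_{1,1}=\frac1{2n}\sum_{k=0}^{2n-1}\epsilon^{-jk}\lambda(a^k)$, $e^j_{2,2}=\frac1{2n}\sum_k\epsilon^{jk}\lambda(a^k)$, $e^j_{1,2}=\frac1{2n}\sum_k\epsilon^{jk}\lambda(ba^k)$, $e^j_{2,1}=\frac1{2n}\sum_k\epsilon^{-jk}\lambda(ba^k)$. Also $e_4=\frac1{4n}\sum_{k=0}^{2n-1}(-1)^k(\lambda(a^k)+\lambda(ba^k))$. Let $(\chi_g)$ be the basis of the dual space dual to $(\lambda(g))$. For $x=\sum_g x_g\lambda(g)$ write $\hat x=\sum_g x_g\chi_g$ (linear extension of $\lambda(g)\mapsto\chi_g$). *)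

(* Defs.v *)
From HB Require Import structures.
From mathcomp Require Import all_boot all_order all_algebra all_fingroup.
From mathcomp Require Import complex.
From mathcomp Require Import reals trigo.

Set Implicit Arguments.
Unset Strict Implicit.
Unset Printing Implicit Defensive.

Import Order.TTheory GRing.Theory Num.Theory.
Local Open Scope ring_scope.

(* A finite-dimensional complex vector space is presented by a basis indexed
   by a finType [B]: a vector is its coordinate function.  The tensor product
   of spaces with bases [B] and [B'] then has basis [B * B']. *)
Definition vec (R : realType) (B : finType) := {ffun B -> R[i]^o}.

Definition ebase (R : realType) (B : finType) (b : B) : vec R B :=
  [ffun b' => (b' == b)%:R].

Definition tensor (R : realType) (B B' : finType) (x : vec R B) (y : vec R B')
  : vec R (B * B')%type :=
  [ffun p => x p.1 * y p.2].

(* f (x) g, for linear f and g *)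
Definition tmap (R : realType) (B1 B2 B1' B2' : finType)
    (f : vec R B1 -> vec R B1') (g : vec R B2 -> vec R B2')
    (X : vec R (B1 * B2)%type) : vec R (B1' * B2')%type :=
  \sum_p X p *: tensor (f (ebase R p.1)) (g (ebase R p.2)).

(* (x1 (x) x2) (y1 (x) y2) = x1 y1 (x) x2 y2 *)
Definition tmul (R : realType) (B : finType)
    (mul : vec R B -> vec R B -> vec R B) (X Y : vec R (B * B)%type)
  : vec R (B * B)%type :=
  \sum_p \sum_q (X p * Y q) *:
    tensor (mul (ebase R p.1) (ebase R q.1)) (mul (ebase R p.2) (ebase R q.2)).

(* (x1 (x) x2)^* = x1^* (x) x2^*, extended antilinearly *)
Definition tstar (R : realType) (B : finType) (star : vec R B -> vec R B)
    (X : vec R (B * B)%type) : vec R (B * B)%type :=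
  \sum_p (X p : R[i])^* *:
    tensor (star (ebase R p.1)) (star (ebase R p.2)).

Record kac_data (R : realType) := KacData {
  kbasis : finType;
  kmul : vec R kbasis -> vec R kbasis -> vec R kbasis;
  kone : vec R kbasis;
  kstar : vec R kbasis -> vec R kbasis;
  kcoprod : vec R kbasis -> vec R (kbasis * kbasis)%type;
  kcounit : vec R kbasis -> R[i]^o;
  kantipode : vec R kbasis -> vec R kbasis
}.

Arguments kone {R} k.

Definition kspace (R : realType) (K : kac_data R) := vec R (kbasis K).

Record is_star_algebra (R : realType) (K : kac_data R) : Prop := {
  kmul_linear_l : forall y : kspace K, linear (fun x => kmul x y);
  kmul_linear_r : forall x : kspace K, linear (kmul x);
  kmulA : forall x y z : kspace K, kmul x (kmul y z) = kmul (kmul x y) z;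
  kmul1x : forall x : kspace K, kmul (kone K) x = x;
  kmulx1 : forall x : kspace K, kmul x (kone K) = x;
  kstar_antilinear : forall (c : R[i]) (x y : kspace K),
    kstar (c *: x + y) = c^* *: kstar x + kstar y;
  kstarK : forall x : kspace K, kstar (kstar x) = x;
  kstarM : forall x y : kspace K, kstar (kmul x y) = kmul (kstar y) (kstar x)
}.

(* Completeness is automatic, the space being finite-dimensional. *)
Record is_cstar_norm (R : realType) (K : kac_data R) (N : kspace K -> R)
  : Prop := {
  cnorm_eq0 : forall x, N x = 0 -> x = 0;
  cnormD : forall x y, N (x + y) <= N x + N y;
  cnormZ : forall (c : R[i]) x, (N (c *: x))%:C%C = `|c| * (N x)%:C%C;
  cnormM : forall x y, N (kmul x y) <= N x * N y;
  cnorm_star : forall x, N (kmul (kstar x) x) = N x ^+ 2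
}.

Record is_hopf (R : realType) (K : kac_data R) : Prop := {
  kcoprod_linear : linear (@kcoprod R K);
  kcoprod1 : kcoprod (kone K) = tensor (kone K) (kone K);
  kcoprodM : forall x y : kspace K,
    kcoprod (kmul x y) = tmul (@kmul R K) (kcoprod x) (kcoprod y);
  (* coordinates of (Delta (x) id) Delta = (id (x) Delta) Delta *)
  kcoprodA : forall (x : kspace K) (i j k : kbasis K),
    tmap (@kcoprod R K) id (kcoprod x) ((i, j), k) =
    tmap id (@kcoprod R K) (kcoprod x) (i, (j, k));
  kcounit_linear : linear (@kcounit R K);
  kcounit1 : kcounit (kone K) = 1;
  kcounitM : forall x y : kspace K, kcounit (kmul x y) = kcounit x * kcounit y;
  kcounit_l : forall x : kspace K,
    \sum_p kcoprod x p *: (kcounit (ebase R p.1) *: ebase R p.2) = x;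
  kcounit_r : forall x : kspace K,
    \sum_p kcoprod x p *: (kcounit (ebase R p.2) *: ebase R p.1) = x;
  kantipode_linear : linear (@kantipode R K);
  kantipode_l : forall x : kspace K,
    \sum_p kcoprod x p *: kmul (kantipode (ebase R p.1)) (ebase R p.2) =
    kcounit x *: kone K;
  kantipode_r : forall x : kspace K,
    \sum_p kcoprod x p *: kmul (ebase R p.1) (kantipode (ebase R p.2)) =
    kcounit x *: kone K
}.

Record is_kac_algebra (R : realType) (K : kac_data R) : Prop := {
  kac_star_algebra : is_star_algebra K;
  kac_cstar : exists N : kspace K -> R, is_cstar_norm N;
  kac_hopf : is_hopf K;
  kac_coprod_star : forall x : kspace K,
    kcoprod (kstar x) = tstar (@kstar R K) (kcoprod x)
}.

Record is_kac_iso (R : realType) (K L : kac_data R)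
    (psi : kspace K -> kspace L) : Prop := {
  kiso_linear : linear psi;
  kiso_bij : bijective psi;
  kiso_mul : forall x y, psi (kmul x y) = kmul (psi x) (psi y);
  kiso_one : psi (kone K) = kone L;
  kiso_star : forall x, psi (kstar x) = kstar (psi x);
  kiso_coprod : forall x, kcoprod (psi x) = tmap psi psi (kcoprod x)
}.

(* The dual space is given by its dual basis: [f : vec R B] is the linear form
   with value [f b] on [ebase R b], and [pairing f x] is f(x). *)
Definition pairing (R : realType) (B : finType) (f x : vec R B) : R[i]^o :=
  \sum_b f b * x b.

Definition kdual (R : realType) (K : kac_data R) : kac_data R :=
  @KacData R (kbasis K)
    (fun f g => [ffun b => pairing (tensor f g) (kcoprod (ebase R b))])
    [ffun b => kcounit (ebase R b)]
    (fun f => [ffun b =>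
       (pairing f (kstar (kantipode (ebase R b))) : R[i])^*])
    (fun f => [ffun p => pairing f (kmul (ebase R p.1) (ebase R p.2))])
    (fun f => pairing f (kone K))
    (fun f => [ffun b => pairing f (kantipode (ebase R b))]).

Definition self_dual (R : realType) (K : kac_data R) : Prop :=
  exists psi : kspace K -> kspace (kdual K), is_kac_iso psi.

(* (gT, a, b) is the dihedral group D_{2n} with its generators: the order forces
   the relations to be a presentation. *)
Definition is_dihedral (n : nat) (gT : finGroupType) (a b : gT) : Prop :=
  [/\ (a ^+ (2 * n) = 1)%g, (b ^+ 2 = 1)%g, (b * a = a^-1 * b)%g,
      <<[set a; b]>>%g = [set: gT] & #|gT| = (4 * n)%N].

Section KD.
Variables (R : realType) (n : nat) (gT : finGroupType) (a b : gT).

Definition lambda (g : gT) : vec R gT := ebase R g.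

Definition gmul (x y : vec R gT) : vec R gT :=
  \sum_g \sum_h (x g * y h) *: lambda (g * h)%g.

Definition gstar (x : vec R gT) : vec R gT :=
  \sum_g (x g : R[i])^* *: lambda g^-1%g.

Definition gcounit (x : vec R gT) : R[i]^o := \sum_g x g.

Definition gantipode (x : vec R gT) : vec R gT :=
  \sum_g x g *: lambda g^-1%g.

Definition Delta_s (x : vec R gT) : vec R (gT * gT)%type :=
  \sum_g x g *: tensor (lambda g) (lambda g).

Definition nu : R[i] := (-1 +i* 2)%C.

Definition omega_h (i : 'I_4) : gT :=
  nth 1%g [:: 1; a ^+ n; b; b * a ^+ n]%g i.

Definition omega_coef : 'M[R[i]]_4 :=
  8^-1 *: \matrix_(i, j) nth 0 (nth [::]
    [:: [:: 5; 1;    1;    1   ];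
        [:: 1; 1;    nu^*; nu  ];
        [:: 1; nu;   1;    nu^*];
        [:: 1; nu^*; nu;   1   ]] i) j.

Definition Omega : vec R (gT * gT)%type :=
  \sum_i \sum_j omega_coef i j *: tensor (lambda (omega_h i)) (lambda (omega_h j)).

Definition KD_coprod (x : vec R gT) : vec R (gT * gT)%type :=
  tmul gmul (tmul gmul Omega (Delta_s x)) (tstar gstar Omega).

Definition KD : kac_data R :=
  KacData gmul (lambda 1%g) gstar KD_coprod gcounit gantipode.

Definition eps : R[i] := (cos (pi / n%:R) +i* sin (pi / n%:R))%C.

Definition e11 (j : int) : vec R gT :=
  (2 * n)%:R^-1 *: \sum_(k < 2 * n) eps ^ (- (j * k%:Z)) *: lambda (a ^+ k)%g.
Definition e22 (j : int) : vec R gT :=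
  (2 * n)%:R^-1 *: \sum_(k < 2 * n) eps ^ (j * k%:Z) *: lambda (a ^+ k)%g.
Definition e12 (j : int) : vec R gT :=
  (2 * n)%:R^-1 *: \sum_(k < 2 * n) eps ^ (j * k%:Z) *: lambda (b * a ^+ k)%g.
Definition e21 (j : int) : vec R gT :=
  (2 * n)%:R^-1 *: \sum_(k < 2 * n) eps ^ (- (j * k%:Z)) *: lambda (b * a ^+ k)%g.

Definition e4 : vec R gT :=
  (4 * n)%:R^-1 *: \sum_(k < 2 * n)
    (-1) ^+ k *: (lambda (a ^+ k)%g + lambda (b * a ^+ k)%g).

(* the basis dual to [lambda], in the coordinates used by [kdual] *)
Definition chi (g : gT) : kspace (kdual KD) := ebase R g.

Definition hat (x : vec R gT) : kspace (kdual KD) := \sum_g x g *: chi g.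

End KD.

(* Main.v *)
From HB Require Import structures.
Require Import Defs.
From mathcomp Require Import all_boot all_order all_algebra all_fingroup.
From mathcomp Require Import sesquilinear complex ring zify.
From mathcomp Require Import classical_sets reals trigo.

(** The map psi is read as a bilinear form on C[D_2n], with matrix
    M(g, h) = psi(lambda g)(lambda h).  With a suitable n-th root of unity zeta
    and C(m) = (zeta^m + zeta^-m) / 2, S(m) = (zeta^m - zeta^-m) / 2, it is
      M(b^s a^j, b^t a^k) = (-1)^(s k + t j) C(j k) + sigma S(j k),
    where sigma is 0, 2, 2i or -2i and depends only on s, t and the parities of
    j and k.  The given images of lambda a and lambda b are two rows of M.

    Why psi is multiplicative ([kdpsiM]).  For n odd, a^n generates a central
    factor of order 2 and D_2n is generated by the rotations of order n together
    with the Klein group {1, a^n, b, b a^n} that carries Omega.  Moving the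
    Klein factors of Omega past a rotation changes S by a sign and fixes C.
    Multiplicativity of psi at h thus becomes, for each value of the parities,
    an identity between sums over the Klein group: a finite table of Gaussian
    rationals ([flip_coefE]), followed by the addition formulas of C and S
    ([kform_convolution], [kdpair_mul]).

    Why psi is bijective ([kdpsi_bij]).  The sum of M(g, h) over h vanishes
    unless g = 1 ([kdpair_sum]), as a sum of powers of a root of unity.  Hence
    the value of psi(lambda(g^-1) x) at the sum of all group elements is 4n
    times the coordinate of x at g, and the kernel of the algebra map psi is 0.

    Everything else is formal.  A bijective algebra map from the group algebra
    to the dual makes the dual algebra associative and unital, which says that
    the coproduct of KD(n) is coassociative and counital ([prekac_hopf]).  The
    other axioms of KD(n) are direct: Omega is unitary, and multiplying the two
    legs of Omega together gives 1, whence the antipode laws ([KD_prekac]).  As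
    M is symmetric, the multiplicativity of psi in one variable of M is its
    compatibility with the coproducts in the other ([symmetric_coprod]).  The
    Hopf axioms of the dual are the transposes of those of KD(n)
    ([kdual_hopf]); its *-algebra structure is transported along psi.

    The C*-norm of KD(n) is the norm of left multiplication operators on the
    space spanned by the group, on which x^* acts as the adjoint of x
    ([opnorm_cstar]); the norm of the dual is its transport along psi. *)

Set Implicit Arguments.
Unset Strict Implicit.
Unset Printing Implicit Defensive.

Import Order.TTheory GRing.Theory Num.Theory.
Import Normc.
Local Open Scope ring_scope.

(** * Linear maps in coordinates *)

Section LinearMaps.
Variables (K : nzRingType) (U V : lmodType K) (f : U -> V).
Hypothesis f_lin : linear f.
Let F : {linear U -> V} :=
  HB.pack f (GRing.isLinear.Build K U V *:%R f f_lin).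

(** The axioms of *-algebras and Hopf algebras assert [linear f] of functions
    without a linear structure; the rules here apply to such a proposition. *)
Lemma lin_sum I (r : seq I) (P : pred I) (E : I -> U) :
  f (\sum_(i <- r | P i) E i) = \sum_(i <- r | P i) f (E i).
Proof. exact: (linear_sum F). Qed.

Lemma linZ c x : f (c *: x) = c *: f x.
Proof. exact: (linearZZ F). Qed.

Lemma linD x y : f (x + y) = f x + f y.
Proof. exact: (linearD F). Qed.

Lemma lin_comp (W : lmodType K) (g : V -> W) :
  linear g -> linear (fun x => g (f x)).
Proof. by move=> g_lin c x y; rewrite f_lin g_lin. Qed.

Lemma lin0 : f 0 = 0.
Proof. exact: (linear0 F). Qed.

End LinearMaps.

(** The exchange of the two middle factors of a fourfold tensor product, which
    relates the product of a tensor square to the coproduct of the dual. *)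
Lemma exchange_middle (A : nmodType) (I : finType) (E : I -> I -> I -> I -> A) :
  \sum_(p : I * I) \sum_(q : I * I) E p.1 p.2 q.1 q.2 =
  \sum_(p : I * I) \sum_(q : I * I) E p.1 q.1 p.2 q.2.
Proof.
have split4 (G : I -> I -> I -> I -> A) :
    \sum_(p : I * I) \sum_(q : I * I) G p.1 p.2 q.1 q.2 =
    \sum_i \sum_j \sum_k \sum_l G i j k l.
  rewrite [RHS]pair_bigA; apply: eq_bigr => p _.
  by rewrite [RHS]pair_bigA.
rewrite split4 (split4 (fun i k j l => E i j k l)).
by apply: eq_bigr => i _; rewrite exchange_big.
Qed.

Section Bases.
Variable R : realType.
Implicit Types B : finType.

Lemma vecD B (x y : vec R B) b : (x + y) b = x b + y b.
Proof. by rewrite ffunE. Qed.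

Lemma vecZ B c (x : vec R B) b : (c *: x) b = c * x b.
Proof. by rewrite ffunE. Qed.

Lemma vec_sum B I (r : seq I) (P : pred I) (E : I -> vec R B) b :
  (\sum_(i <- r | P i) E i) b = \sum_(i <- r | P i) E i b.
Proof. exact: sum_ffunE. Qed.

Lemma sum_delta B (b : B) (E : B -> R[i]) :
  \sum_b' (b' == b)%:R * E b' = E b.
Proof.
rewrite (bigD1 b) //= eqxx mul1r big1 ?addr0 // => b' /negPf ->.
by rewrite mul0r.
Qed.

Lemma ebaseE B (b b' : B) : ebase R b b' = (b' == b)%:R.
Proof. by rewrite ffunE. Qed.

Lemma vec_expand B (x : vec R B) : x = \sum_b x b *: ebase R b.
Proof.
apply/ffunP => b; rewrite vec_sum -[LHS](sum_delta b (fun b' => x b')).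
by apply: eq_bigr => b' _; rewrite vecZ ebaseE mulrC eq_sym.
Qed.

Lemma sum_ebase (V : lmodType R[i]) B (b : B) (F : B -> V) :
  \sum_b' ebase R b b' *: F b' = F b.
Proof.
rewrite (bigD1 b) //= ebaseE eqxx scale1r big1 ?addr0 // => b' /negPf nb.
by rewrite ebaseE nb scale0r.
Qed.

Lemma lin_expand B (V : lmodType R[i]) (f : vec R B -> V) :
  linear f -> forall x, f x = \sum_b x b *: f (ebase R b).
Proof.
move=> f_lin x; rewrite {1}[x]vec_expand lin_sum //.
by apply: eq_bigr => b _; rewrite linZ.
Qed.

Lemma lin_eq B (V : lmodType R[i]) (f g : vec R B -> V) :
    linear f -> linear g -> (forall b, f (ebase R b) = g (ebase R b)) ->
  forall x, f x = g x.
Proof.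
move=> f_lin g_lin fg x; rewrite (lin_expand f_lin) (lin_expand g_lin).
by apply: eq_bigr => b _; rewrite fg.
Qed.

Lemma tensorE B B' (x : vec R B) (y : vec R B') p :
  tensor x y p = x p.1 * y p.2.
Proof. by rewrite ffunE. Qed.

Lemma tensor_linear_l B B' (y : vec R B') :
  linear (fun x : vec R B => tensor x y).
Proof.
by move=> c x x'; apply/ffunP => p; rewrite !(tensorE, vecD, vecZ); ring.
Qed.

Lemma tensor_linear_r B B' (x : vec R B) :
  linear (fun y : vec R B' => tensor x y).
Proof.
by move=> c y y'; apply/ffunP => p; rewrite !(tensorE, vecD, vecZ); ring.
Qed.

Lemma ebase_pair B B' (p : B * B') :
  ebase R p = tensor (ebase R p.1) (ebase R p.2).
Proof.
apply/ffunP => q; rewrite tensorE !ebaseE -natrM mulnb.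
by case: p q => [b b'] [c c'].
Qed.

(** A bilinear map, evaluated on the coordinates of a pure tensor: this turns
    the coordinate sums in the Hopf axioms into honest values of [F]. *)
Lemma sum_tensor B B' (V : lmodType R[i]) (F : vec R B -> vec R B' -> V) x y :
    (forall y, linear (F^~ y)) -> (forall x, linear (F x)) ->
  \sum_p tensor x y p *: F (ebase R p.1) (ebase R p.2) = F x y.
Proof.
move=> Fl Fr; under eq_bigr do rewrite tensorE.
rewrite -(pair_bigA _ (fun b b' =>
  (x b * y b') *: F (ebase R b) (ebase R b'))) (lin_expand (Fl y) x) /=.
apply: eq_bigr => b _; rewrite (lin_expand (Fr _) y) scaler_sumr.
by apply: eq_bigr => b' _; rewrite scalerA.
Qed.

Lemma pairing_linear_l B (x : vec R B) : linear (fun f => pairing f x : R[i]^o).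
Proof.
move=> c f g; rewrite /pairing /GRing.scale /= mulr_sumr -big_split.
by apply: eq_bigr => b _; rewrite vecD vecZ /=; ring.
Qed.

Lemma pairing_linear_r B (f : vec R B) : linear (pairing f).
Proof.
move=> c x y; rewrite /pairing /GRing.scale /= mulr_sumr -big_split.
by apply: eq_bigr => b _; rewrite vecD vecZ /=; ring.
Qed.

Lemma pairingDl B (f g x : vec R B) :
  pairing (f + g) x = pairing f x + pairing g x.
Proof. exact: (linD (pairing_linear_l x)). Qed.

Lemma pairingZl B c (f x : vec R B) : pairing (c *: f) x = c * pairing f x.
Proof. exact: (linZ (pairing_linear_l x) c f). Qed.

Lemma pairing_suml B I (r : seq I) (P : pred I) (E : I -> vec R B) x :
  pairing (\sum_(i <- r | P i) E i) x = \sum_(i <- r | P i) pairing (E i) x.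
Proof. exact: (lin_sum (pairing_linear_l x)). Qed.

Lemma pairingDr B (f x y : vec R B) :
  pairing f (x + y) = pairing f x + pairing f y.
Proof. exact: (linD (pairing_linear_r f)). Qed.

Lemma pairingZr B c (f x : vec R B) : pairing f (c *: x) = c * pairing f x.
Proof. exact: (linZ (pairing_linear_r f) c x). Qed.

Lemma pairing_sumr B I (r : seq I) (P : pred I) (E : I -> vec R B) f :
  pairing f (\sum_(i <- r | P i) E i) = \sum_(i <- r | P i) pairing f (E i).
Proof. exact: (lin_sum (pairing_linear_r f)). Qed.

Lemma pairingC B (f x : vec R B) : pairing f x = pairing x f.
Proof. by apply: eq_bigr => b _; rewrite mulrC. Qed.

Lemma pairing_ebase B (f : vec R B) b : pairing f (ebase R b) = f b.
Proof.
rewrite /pairing -[RHS](sum_delta b (fun b' => f b')).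
by apply: eq_bigr => b' _; rewrite ebaseE mulrC.
Qed.

Lemma ebase_pairing B (x : vec R B) b : pairing (ebase R b) x = x b.
Proof. by rewrite pairingC pairing_ebase. Qed.

Lemma pairing_tensor B B' (f x : vec R B) (g y : vec R B') :
  pairing (tensor f g) (tensor x y) = pairing f x * pairing g y.
Proof.
rewrite /pairing mulr_suml; under eq_bigr do rewrite !tensorE.
rewrite -(pair_bigA _ (fun b b' => f b * g b' * (x b * y b'))) /=.
apply: eq_bigr => b _; rewrite mulr_sumr.
by apply: eq_bigr => b' _; rewrite mulrACA.
Qed.

Lemma eq_pairing B (f g : vec R B) :
  (forall x, pairing f x = pairing g x) -> f = g.
Proof. by move=> fg; apply/ffunP => b; rewrite -!pairing_ebase. Qed.

Lemma tmapE B1 B2 B1' B2' (f : vec R B1 -> vec R B1') (g : vec R B2 -> vec R B2')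
    X p :
  tmap f g X p = \sum_q X q * (f (ebase R q.1) p.1 * g (ebase R q.2) p.2).
Proof.
by rewrite /tmap vec_sum; apply: eq_bigr => q _; rewrite vecZ tensorE.
Qed.

Lemma tmulE B (mul : vec R B -> vec R B -> vec R B) X Y p :
  tmul mul X Y p = \sum_q \sum_q' X q * Y q' *
    (mul (ebase R q.1) (ebase R q'.1) p.1 * mul (ebase R q.2) (ebase R q'.2) p.2).
Proof.
rewrite /tmul vec_sum; apply: eq_bigr => q _; rewrite vec_sum.
by apply: eq_bigr => q' _; rewrite vecZ tensorE.
Qed.

End Bases.

(** * The dual of a Hopf algebra *)

Section DualPairings.
Variables (R : realType) (K : kac_data R).
Hypothesis coprod_lin : linear (@kcoprod R K).
Local Notation e := (ebase R).
Local Notation dual := (kdual K).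
Local Notation dmul := (@kmul R dual).
Local Notation dcoprod := (@kcoprod R dual).
Local Notation dantipode := (@kantipode R dual).
Implicit Types (f g h : kspace dual) (x y : kspace K) (i j k : kbasis K).

Lemma dual_mulP f g x :
  pairing (dmul f g) x = pairing (tensor f g) (kcoprod x).
Proof.
rewrite (lin_expand coprod_lin) pairing_sumr.
apply: eq_bigr => b _; rewrite pairingZr ffunE.
by rewrite /GRing.scale /= mulrC.
Qed.

Lemma dual_mul_ebase i j x :
  pairing (dmul (e i) (e j)) x = kcoprod x (i, j).
Proof. by rewrite dual_mulP -(ebase_pair R (i, j)) ebase_pairing. Qed.

(** The two iterated coproducts of [x] are the two ways to multiply three
    linear forms at [x].  So coassociativity can be read off from associativity
    of the dual, and [dual_mul1f], [dual_mulf1] do the same for the counit laws. *)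
Lemma dual_mulA_l i j k x :
  pairing (dmul (dmul (e i) (e j)) (e k)) x =
  tmap (@kcoprod R K) id (kcoprod x) ((i, j), k).
Proof.
rewrite dual_mulP tmapE; apply: eq_bigr => q _; rewrite tensorE mulrC.
by rewrite -dual_mul_ebase pairing_ebase !ebaseE eq_sym.
Qed.

Lemma dual_mulA_r i j k x :
  pairing (dmul (e i) (dmul (e j) (e k))) x =
  tmap id (@kcoprod R K) (kcoprod x) (i, (j, k)).
Proof.
rewrite dual_mulP tmapE; apply: eq_bigr => q _; rewrite tensorE mulrC.
by rewrite -dual_mul_ebase pairing_ebase !ebaseE eq_sym.
Qed.

Lemma dual_mul1f j x :
  pairing (dmul (kone dual) (e j)) x =
  (\sum_p kcoprod x p *: (kcounit (e p.1) *: e p.2)) j.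
Proof.
rewrite dual_mulP vec_sum; apply: eq_bigr => p _.
by rewrite !(vecZ, tensorE, ffunE) eq_sym mulrC.
Qed.

Lemma dual_mulf1 j x :
  pairing (dmul (e j) (kone dual)) x =
  (\sum_p kcoprod x p *: (kcounit (e p.2) *: e p.1)) j.
Proof.
rewrite dual_mulP vec_sum; apply: eq_bigr => p _.
by rewrite !(vecZ, tensorE, ffunE) eq_sym mulrC [_ * kcounit _]mulrC.
Qed.

End DualPairings.

Section DualHopf.
Variables (R : realType) (K : kac_data R).
Hypotheses (algK : is_star_algebra K) (hopfK : is_hopf K).
Local Notation e := (ebase R).
Local Notation dual := (kdual K).
Local Notation mul := (@kmul R K).
Local Notation dmul := (@kmul R dual).
Local Notation dcoprod := (@kcoprod R dual).
Local Notation dantipode := (@kantipode R dual).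
Implicit Types (f g h : kspace dual) (x y : kspace K) (i j k : kbasis K).

Lemma dual_counitP x : pairing (kone dual) x = kcounit x.
Proof.
rewrite (lin_expand (kcounit_linear hopfK)).
by apply: eq_bigr => b _; rewrite ffunE mulrC.
Qed.

Lemma dual_antipodeP f x :
  pairing (dantipode f) x = pairing f (kantipode x).
Proof.
rewrite (lin_expand (kantipode_linear hopfK)) pairing_sumr.
apply: eq_bigr => b _; rewrite pairingZr ffunE.
by rewrite /GRing.scale /= mulrC.
Qed.

Lemma dual_coprodP f x y :
  pairing (dcoprod f) (tensor x y) =
  pairing f (kmul x y).
Proof.
rewrite -(@sum_tensor _ _ _ (R[i]^o : lmodType _)
  (fun x y => pairing f (kmul x y)) x y).
- by apply: eq_bigr => p _; rewrite ffunE /GRing.scale /= mulrC.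
- move=> y' c x1 x2; rewrite (kmul_linear_l algK) pairingDr.
  by rewrite pairingZr.
- move=> x' c y1 y2; rewrite (kmul_linear_r algK) pairingDr.
  by rewrite pairingZr.
Qed.

(** Duality exchanges products with coproducts and units with counits, and
    transposes the antipode; each axiom of the dual is the transpose of an axiom
    of [K], checked by evaluating linear forms. *)
Lemma kdual_hopf : is_hopf dual.
Proof.
have coplin := kcoprod_linear hopfK.
have coprodE f (p : kbasis K * kbasis K) :
  dcoprod f p = pairing f (kmul (e p.1) (e p.2)) by rewrite ffunE.
have mulE i j k : dmul (e i) (e j) k = kcoprod (e k) (i, j).
  by rewrite -(dual_mul_ebase coplin) pairing_ebase.
have antipodeE i j : dantipode (e i) j = kantipode (e j) i.
  by rewrite -pairing_ebase dual_antipodeP ebase_pairing.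
have counitE f : kcounit f = pairing f (kone K) by [].
split.
- move=> c f g; apply/ffunP => p; rewrite vecD vecZ !coprodE.
  by rewrite pairingDl pairingZl.
- apply/ffunP => p; rewrite coprodE tensorE dual_counitP (kcounitM hopfK).
  by rewrite -!dual_counitP !pairing_ebase.
- move=> f g; apply/ffunP => -[i j]; rewrite coprodE (dual_mulP coplin).
  rewrite (kcoprodM hopfK) tmulE.
  under [RHS]eq_bigr do under eq_bigr do rewrite !mulE !coprodE /=.
  rewrite (exchange_middle (fun a b c d : kbasis K =>
    pairing f (mul (e a) (e b)) * pairing g (mul (e c) (e d)) *
    (@kcoprod R K (e i) (a, c) * @kcoprod R K (e j) (b, d)))).
  rewrite pairing_sumr; apply: eq_bigr => p _.
  rewrite pairing_sumr; apply: eq_bigr => q _.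
  rewrite pairingZr pairing_tensor /GRing.scale /= mulrC.
  by rewrite -!surjective_pairing.
- move=> f i j k; rewrite !tmapE.
  transitivity (pairing (dcoprod f) (tensor (mul (e i) (e j)) (e k))).
    apply: eq_bigr => q _; rewrite tensorE [dcoprod (e _) _]coprodE.
    by rewrite ebase_pairing !ebaseE eq_sym.
  transitivity (pairing (dcoprod f) (tensor (e i) (mul (e j) (e k)))).
    by rewrite !dual_coprodP (kmulA algK).
  apply: eq_bigr => q _; rewrite tensorE [dcoprod (e _) _]coprodE.
  by rewrite ebase_pairing !ebaseE eq_sym.
- by move=> c f g; exact: pairing_linear_l.
- by rewrite counitE dual_counitP (kcounit1 hopfK).
- move=> f g; rewrite !counitE (dual_mulP coplin) (kcoprod1 hopfK).
  exact: pairing_tensor.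
- move=> f; apply/ffunP => j.
  rewrite -[RHS]pairing_ebase -[in RHS](kmul1x algK (e j)) -dual_coprodP vec_sum.
  apply: eq_bigr => p _; rewrite !vecZ counitE tensorE ebase_pairing.
  by rewrite !ebaseE eq_sym.
- move=> f; apply/ffunP => j.
  rewrite -[RHS]pairing_ebase -[in RHS](kmulx1 algK (e j)) -dual_coprodP vec_sum.
  apply: eq_bigr => p _; rewrite !vecZ counitE tensorE ebase_pairing.
  by rewrite !ebaseE eq_sym [_ * kone K _]mulrC.
- move=> c f g; apply: eq_pairing => x; rewrite dual_antipodeP.
  rewrite !pairingDl !pairingZl.
  by rewrite !dual_antipodeP.
- move=> f; apply: eq_pairing => x.
  rewrite pairingZl dual_counitP.
  transitivity (pairing f (@kcounit R K x *: kone K)); last first.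
    by rewrite pairingZr /GRing.scale /= mulrC.
  rewrite -(kantipode_l hopfK) pairing_suml.
  rewrite pairing_sumr.
  under [RHS]eq_bigr do rewrite pairingZr -dual_coprodP.
  under [LHS]eq_bigr do rewrite pairingZl (dual_mulP coplin).
  rewrite /pairing /GRing.scale /=.
  under eq_bigr do rewrite mulr_sumr; rewrite exchange_big /=.
  apply: eq_bigr => q _; rewrite mulr_sumr; apply: eq_bigr => p _.
  by rewrite !tensorE antipodeE !ebaseE eq_sym; ring.
- move=> f; apply: eq_pairing => x.
  rewrite pairingZl dual_counitP.
  transitivity (pairing f (@kcounit R K x *: kone K)); last first.
    by rewrite pairingZr /GRing.scale /= mulrC.
  rewrite -(kantipode_r hopfK) pairing_suml.
  rewrite pairing_sumr.
  under [RHS]eq_bigr do rewrite pairingZr -dual_coprodP.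
  under [LHS]eq_bigr do rewrite pairingZl (dual_mulP coplin).
  rewrite /pairing /GRing.scale /=.
  under eq_bigr do rewrite mulr_sumr; rewrite exchange_big /=.
  apply: eq_bigr => q _; rewrite mulr_sumr; apply: eq_bigr => p _.
  by rewrite !tensorE antipodeE !ebaseE eq_sym; ring.
Qed.

End DualHopf.

(** * Transport of structure and symmetric self-pairings *)

Section StarAlgebra.
Variables (R : realType) (K : kac_data R).
Hypothesis algK : is_star_algebra K.
Implicit Types x y : kspace K.

Lemma kstarD x y : kstar (x + y) = kstar x + kstar y.
Proof. by have := kstar_antilinear algK 1 x y; rewrite conjC1 !scale1r. Qed.

Lemma kstar0 : kstar (0 : kspace K) = 0.
Proof. by have /eqP := kstarD 0 0; rewrite addr0 -subr_eq subrr => /eqP. Qed.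

Lemma kstarZ (c : R[i]) x : kstar (c *: x) = c^* *: kstar x.
Proof.
by have := kstar_antilinear algK c x 0; rewrite kstar0 !addr0.
Qed.

Lemma kstar_sum I (r : seq I) (P : pred I) (E : I -> kspace K) :
  kstar (\sum_(i <- r | P i) E i) = \sum_(i <- r | P i) kstar (E i).
Proof. exact: (big_morph _ kstarD kstar0). Qed.

End StarAlgebra.

Section DualStar.
Variables (R : realType) (K : kac_data R).
Hypotheses (algK : is_star_algebra K) (S_lin : linear (@kantipode R K)).
Hypothesis SM : forall x y : kspace K,
  kantipode (kmul x y) = kmul (kantipode y) (kantipode x).
Local Notation dual := (kdual K).
Local Notation dstar := (@kstar R dual).
Local Notation dcoprod := (@kcoprod R dual).
Local Notation S := (@kantipode R K).

Lemma dual_starP (f : kspace dual) (x : kspace K) :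
  pairing (dstar f) x = (pairing f (kstar (S x)) : R[i])^*.
Proof.
rewrite (lin_expand S_lin) (kstar_sum algK) pairing_sumr rmorph_sum.
apply: eq_bigr => b _; rewrite (kstarZ algK) pairingZr rmorphM /= conjCK mulrC.
by rewrite ffunE.
Qed.

(** Both sides evaluate a form at conjugates of values of the antipode, because
    x |-> S(x)^* is multiplicative: [S] and the involution both reverse products. *)
Lemma dual_coprod_star (f : kspace dual) :
  dcoprod (dstar f) = tstar dstar (dcoprod f).
Proof.
have dual_starE i j : dstar (ebase R i) j = (kstar (S (ebase R j)) i : R[i])^*.
  by rewrite -pairing_ebase dual_starP ebase_pairing.
apply/ffunP => -[i j]; rewrite [LHS]ffunE dual_starP SM (kstarM algK).
rewrite -(dual_coprodP algK) rmorph_sum /tstar vec_sum; apply: eq_bigr => p _.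
by rewrite vecZ !tensorE !rmorphM /= !dual_starE.
Qed.

End DualStar.

Section Transport.
Variables (R : realType) (K L : kac_data R) (psi : kspace K -> kspace L).
Hypothesis algK : is_star_algebra K.
Hypotheses (psi_lin : linear psi) (psi_bij : bijective psi).
Hypothesis psiM : forall x y, psi (kmul x y) = kmul (psi x) (psi y).
Hypothesis psi1 : psi (kone K) = kone L.
Hypothesis psi_star : forall x, psi (kstar x) = kstar (psi x).

(** Every element of [L] is a value of [psi], so each axiom for [L] is the
    image of the same axiom for [K]. *)
Lemma transport_star_algebra : is_star_algebra L.
Proof.
case: psi_bij => phi psiK phiK.
have psi_surj y : exists x, y = psi x by exists (phi y); rewrite phiK.
split.
- move=> y c x x'.
  have [[[u ->] [v ->]] [w ->]] := (psi_surj y, psi_surj x, psi_surj x').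
  by rewrite -psi_lin -!psiM (kmul_linear_l algK) psi_lin.
- move=> x c y y'.
  have [[[u ->] [v ->]] [w ->]] := (psi_surj x, psi_surj y, psi_surj y').
  by rewrite -psi_lin -!psiM (kmul_linear_r algK) psi_lin.
- move=> x y z.
  have [[[u ->] [v ->]] [w ->]] := (psi_surj x, psi_surj y, psi_surj z).
  by rewrite -!psiM (kmulA algK).
- by move=> x; have [u ->] := psi_surj x; rewrite -psi1 -psiM (kmul1x algK).
- by move=> x; have [u ->] := psi_surj x; rewrite -psi1 -psiM (kmulx1 algK).
- move=> c x y; have [[u ->] [v ->]] := (psi_surj x, psi_surj y).
  by rewrite -psi_lin -!psi_star (kstar_antilinear algK) psi_lin.
- by move=> x; have [u ->] := psi_surj x; rewrite -!psi_star (kstarK algK).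
- move=> x y; have [[u ->] [v ->]] := (psi_surj x, psi_surj y).
  by rewrite -!(psi_star, psiM) (kstarM algK).
Qed.

Lemma transport_cstar_norm :
  (exists N : kspace K -> R, is_cstar_norm N) ->
  exists N : kspace L -> R, is_cstar_norm N.
Proof.
case: psi_bij => phi psiK phiK [N normN].
have psi_surj y : exists x, y = psi x by exists (phi y); rewrite phiK.
exists (N \o phi); split=> /=.
- move=> x /(cnorm_eq0 normN) x0; rewrite -[x]phiK x0; exact: lin0.
- move=> x y; have [[u ->] [v ->]] := (psi_surj x, psi_surj y).
  by rewrite -(linD psi_lin) !psiK (cnormD normN).
- move=> c x; have [u ->] := psi_surj x.
  by rewrite -(linZ psi_lin) !psiK (cnormZ normN).
- move=> x y; have [[u ->] [v ->]] := (psi_surj x, psi_surj y).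
  by rewrite -psiM !psiK (cnormM normN).
- move=> x; have [u ->] := psi_surj x.
  by rewrite -psi_star -psiM !psiK (cnorm_star normN).
Qed.

End Transport.

(** A Kac algebra stripped of coassociativity and of the counit laws, which
    [prekac_hopf] recovers from a bijective algebra map to the dual; the
    antimultiplicativity of the antipode is recorded because it makes the
    coproduct of the dual a *-map. *)
Record is_prekac (R : realType) (K : kac_data R) : Prop := {
  pk_star_algebra : is_star_algebra K;
  pk_cstar : exists N : kspace K -> R, is_cstar_norm N;
  pk_coprod_linear : linear (@kcoprod R K);
  pk_coprod1 : kcoprod (kone K) = tensor (kone K) (kone K);
  pk_coprodM : forall x y : kspace K,
    kcoprod (kmul x y) = tmul (@kmul R K) (kcoprod x) (kcoprod y);
  pk_counit_linear : linear (@kcounit R K);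
  pk_counit1 : kcounit (kone K) = 1;
  pk_counitM : forall x y : kspace K,
    kcounit (kmul x y) = kcounit x * kcounit y;
  pk_antipode_linear : linear (@kantipode R K);
  pk_antipode_l : forall x : kspace K,
    \sum_p kcoprod x p *: kmul (kantipode (ebase R p.1)) (ebase R p.2) =
    kcounit x *: kone K;
  pk_antipode_r : forall x : kspace K,
    \sum_p kcoprod x p *: kmul (ebase R p.1) (kantipode (ebase R p.2)) =
    kcounit x *: kone K;
  pk_coprod_star : forall x : kspace K,
    kcoprod (kstar x) = tstar (@kstar R K) (kcoprod x);
  pk_antipodeM : forall x y : kspace K,
    kantipode (kmul x y) = kmul (kantipode y) (kantipode x)
}.

Section PreKac.
Variables (R : realType) (K : kac_data R).
Variable psi : kspace K -> kspace (kdual K).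
Hypothesis preK : is_prekac K.
Hypotheses (psi_lin : linear psi) (psi_bij : bijective psi).
Hypothesis psi_sym : forall x y, pairing (psi x) y = pairing (psi y) x.
Hypothesis psiM : forall x y, psi (kmul x y) = kmul (psi x) (psi y).
Hypothesis psi1 : psi (kone K) = kone (kdual K).
Hypothesis psi_star : forall x, psi (kstar x) = kstar (psi x).
Local Notation e := (ebase R).

Let algK := pk_star_algebra preK.
Let coplin := pk_coprod_linear preK.

Lemma dual_star_algebra : is_star_algebra (kdual K).
Proof. exact: transport_star_algebra psi_star. Qed.

(** Through [psi], the dual inherits associativity and the unit laws of [K].
    Transposed, they are coassociativity and the counit laws of [K]. *)
Lemma prekac_hopf : is_hopf K.
Proof.
have algD := dual_star_algebra; case: preK => *; split=> // x.
- by move=> i j k; rewrite -dual_mulA_l // -dual_mulA_r // (kmulA algD).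
- apply/ffunP => j; rewrite -(dual_mul1f coplin) (kmul1x algD).
  exact: ebase_pairing.
- apply/ffunP => j; rewrite -(dual_mulf1 coplin) (kmulx1 algD).
  exact: ebase_pairing.
Qed.

(** By symmetry, psi(x)(y z) = psi(y z)(x) = (psi(y) psi(z))(x), and the last
    value is computed from the coproduct of [x]. *)
Lemma symmetric_coprod x : kcoprod (psi x) = tmap psi psi (kcoprod x).
Proof.
apply/ffunP => -[i j]; rewrite [LHS]ffunE psi_sym psiM (dual_mulP coplin) tmapE.
apply: eq_bigr => q _; rewrite tensorE mulrC.
by congr (_ * (_ * _)); rewrite -pairing_ebase psi_sym pairing_ebase.
Qed.

Lemma symmetric_prekac_iso : is_kac_iso psi.
Proof. split=> //; exact: symmetric_coprod. Qed.

Lemma prekac_kac : is_kac_algebra K.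
Proof.
split; [exact: algK | exact: pk_cstar | exact: prekac_hopf |].
exact: pk_coprod_star.
Qed.

Lemma prekac_kac_dual : is_kac_algebra (kdual K).
Proof.
split; [exact: dual_star_algebra | | |].
- exact: (transport_cstar_norm psi_lin psi_bij psiM psi_star (pk_cstar preK)).
- exact: (kdual_hopf algK prekac_hopf).
- exact: (dual_coprod_star algK (pk_antipode_linear preK) (pk_antipodeM preK)).
Qed.

End PreKac.

(** * Operator norms *)

Lemma normcC (R : realType) (c : R[i]) : (normc c)%:C%C = `|c|.
Proof. by []. Qed.

Section Hermitian.
Variables (R : realType) (B : finType).
Implicit Types x y : vec R B.

(** The hermitian form for which the basis is orthonormal. *)
Definition hdot x y : R[i] := \sum_b x b * (y b : R[i])^*.

Lemma hdot_linear_l y : linear (fun x => hdot x y : R[i]^o).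
Proof.
move=> c x x'; rewrite /hdot /GRing.scale /= mulr_sumr -big_split.
by apply: eq_bigr => b _; rewrite vecD vecZ /=; ring.
Qed.

Lemma hdotC x y : hdot x y = (hdot y x)^*.
Proof.
rewrite /hdot rmorph_sum; apply: eq_bigr => b _.
by rewrite rmorphM /= conjCK mulrC.
Qed.

Lemma hdot_bilinear : bilinear_for *%R (Num.conj \; *%R) hdot.
Proof.
split=> [y|x] c x1 x2; first exact: (hdot_linear_l y c x1 x2).
rewrite /= hdotC (hdot_linear_l x c x1 x2) rmorphD /= rmorphM /=.
by rewrite -!hdotC.
Qed.

Lemma hdot_hermitian x y : hdot x y = (-1) ^+ false * (hdot y x)^*.
Proof. by rewrite mul1r -hdotC. Qed.

Lemma hdot_gt0 x : x != 0 -> 0 < hdot x x.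
Proof.
move=> x0; have /existsP [b xb] : [exists b, x b != 0].
  apply: contra_neqT x0 => /existsPn x0.
  by apply/ffunP => b; rewrite ffunE; apply/eqP/negbNE.
rewrite /hdot (bigD1 b) //= ltr_pwDl ?mul_conjC_gt0 //.
by apply: sumr_ge0 => b' _; rewrite mul_conjC_ge0.
Qed.

HB.instance Definition _ := bilinear_isBilinear.Build
  R[i] (vec R B) (vec R B) R[i] *%R (Num.conj \; *%R) hdot hdot_bilinear.
HB.instance Definition _ := isHermitianSesquilinear.Build
  R[i] (vec R B) false Num.conj hdot hdot_hermitian.
HB.instance Definition _ := isDotProduct.Build R[i] (vec R B) hdot hdot_gt0.


Definition l2 x : R := complex.Re (sqrtC (hdot x x)).

Lemma l2C x : (l2 x)%:C%C = sqrtC (hdot x x).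
Proof. by rewrite RRe_real // ger0_real // sqrtC_ge0 (dnorm_ge0 hdot). Qed.

Lemma l2_sqr x : (l2 x ^+ 2)%:C%C = hdot x x.
Proof. by rewrite rmorphXn /= l2C sqrtCK. Qed.

Lemma l2_ge0 x : 0 <= l2 x.
Proof. by rewrite -ler0c l2C sqrtC_ge0 (dnorm_ge0 hdot). Qed.

Lemma l2_eq0 x : l2 x = 0 -> x = 0.
Proof.
move=> x0; apply/eqP; rewrite -(dnorm_eq0 hdot) /=; apply/eqP.
by rewrite -l2_sqr x0 expr0n.
Qed.

Lemma l20 : l2 0 = 0.
Proof.
apply: complexI; rewrite l2C; apply/eqP; rewrite sqrtC_eq0.
by rewrite (dnorm_eq0 hdot).
Qed.

Lemma l2D x y : l2 (x + y) <= l2 x + l2 y.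
Proof. by rewrite -lecR rmorphD /= !l2C (triangle_lerif hdot). Qed.

Lemma l2Z (c : R[i]) x : l2 (c *: x) = normc c * l2 x.
Proof.
apply: complexI; rewrite rmorphM /= !l2C (dnormZ hdot) sqrtCM ?nnegrE.
- by rewrite sqrCK ?normr_ge0.
- by rewrite exprn_ge0 ?normr_ge0.
- exact: (dnorm_ge0 hdot).
Qed.

Lemma hdot_le x y : `|hdot x y| <= (l2 x * l2 y)%:C%C.
Proof. by rewrite rmorphM /= !l2C (CauchySchwarz_sqrt hdot). Qed.

Lemma l2_sum I (r : seq I) (P : pred I) (E : I -> vec R B) :
  l2 (\sum_(i <- r | P i) E i) <= \sum_(i <- r | P i) l2 (E i).
Proof.
elim/big_rec2: _ => [|i s x _ sx]; first by rewrite l20.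
by rewrite (le_trans (l2D _ _)) // lerD2l.
Qed.

(** Cauchy-Schwarz against a basis vector. *)
Lemma coord_le_l2 x b : normc (x b) <= l2 x.
Proof.
have hdot_ebase u : hdot u (ebase R b) = u b.
  rewrite /hdot -[RHS](sum_delta b (fun b' => u b')).
  by apply: eq_bigr => b' _; rewrite ebaseE conjC_nat mulrC.
have l2_ebase : l2 (ebase R b) = 1.
  by apply: complexI; rewrite l2C hdot_ebase ebaseE eqxx sqrtC1.
by rewrite -lecR normcC -hdot_ebase -[l2 x]mulr1 -l2_ebase hdot_le.
Qed.

End Hermitian.

Section OperatorNorm.
Variables (R : realType) (K : kac_data R).
Hypothesis algK : is_star_algebra K.
Hypothesis hdot_star : forall x y z : kspace K,
  hdot (kmul x y) z = hdot y (kmul (kstar x) z).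
Implicit Types x y : kspace K.

(** The norm of left multiplication by [x] on the Hilbert space spanned by the
    basis; it satisfies the C*-identity as soon as the involution of [K] is the
    adjoint for [hdot]. *)
Definition opnorm x : R :=
  sup [set l2 (kmul x y) | y in [set y : kspace K | l2 y <= 1]].

Let mul0 x : kmul x 0 = 0.
Proof. exact: lin0 (kmul_linear_r algK x). Qed.

(** Each coordinate of a vector of the unit ball is at most 1, so the norms of
    the products of [x] with the basis vectors add up to a bound. *)
Lemma opnorm_bounded x :
  has_ubound [set l2 (kmul x y) | y in [set y : kspace K | l2 y <= 1]].
Proof.
exists (\sum_b l2 (kmul x (ebase R b))) => _ [y y1 <-].
rewrite (lin_expand (kmul_linear_r algK x) y).
apply: (le_trans (l2_sum _ _ _)); apply: ler_sum => b _.
rewrite l2Z -[leRHS]mul1r ler_wpM2r ?l2_ge0 //.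
exact: le_trans (coord_le_l2 y b) y1.
Qed.

Lemma opnorm_ub x y : l2 y <= 1 -> l2 (kmul x y) <= opnorm x.
Proof. by move=> y1; apply: (ub_le_sup (opnorm_bounded x)); exists y. Qed.

Lemma opnorm_least x M :
  (forall y, l2 y <= 1 -> l2 (kmul x y) <= M) -> opnorm x <= M.
Proof.
move=> xM; apply: ge_sup => [|_ [y y1 <-]]; last exact: xM.
by exists (l2 (kmul x 0)); exists 0 => //=; rewrite l20.
Qed.

Lemma opnorm_ge0 x : 0 <= opnorm x.
Proof. by rewrite -(l20 R (kbasis K)) -(mul0 x) opnorm_ub ?l20. Qed.

Lemma opnormP x y : l2 (kmul x y) <= opnorm x * l2 y.
Proof.
(* A nonzero y is rescaled to the unit sphere. *)
have [y0|y_neq0] := eqVneq (l2 y) 0.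
  by rewrite (l2_eq0 y0) mul0 l20 mulr0.
have y_gt0 : 0 < l2 y by rewrite lt_neqAle eq_sym y_neq0 l2_ge0.
have normcV_l2 : normc ((l2 y)^-1)%:C%C = (l2 y)^-1.
  by apply: complexI; rewrite normcC ger0_norm // ler0c invr_ge0 l2_ge0.
rewrite -ler_pdivrMr // mulrC -normcV_l2 -l2Z -(linZ (kmul_linear_r algK x)).
by apply: opnorm_ub; rewrite l2Z normcV_l2 mulVf.
Qed.

Lemma opnormZ_le (c : R[i]) x : opnorm (c *: x) <= normc c * opnorm x.
Proof.
apply: opnorm_least => y y1; rewrite (linZ (kmul_linear_l algK y)) l2Z.
by rewrite ler_wpM2l ?opnorm_ub // -ler0c normcC normr_ge0.
Qed.

Lemma opnormM x y : opnorm (kmul x y) <= opnorm x * opnorm y.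
Proof.
apply: opnorm_least => z z1; rewrite -(kmulA algK).
by apply: (le_trans (opnormP _ _)); rewrite ler_wpM2l ?opnorm_ge0 ?opnorm_ub.
Qed.

(** The square of the norm of [x y] is the value of the form at [y] and
    [x^* x y], which Cauchy-Schwarz bounds. *)
Lemma opnorm_sqr_le x : opnorm x ^+ 2 <= opnorm (kmul (kstar x) x).
Proof.
have Nxx := opnorm_ge0 (kmul (kstar x) x).
rewrite -(sqr_sqrtr Nxx) ler_sqr ?nnegrE ?opnorm_ge0 ?sqrtr_ge0 //.
apply: opnorm_least => y y1.
rewrite -[leLHS]ger0_norm ?l2_ge0 // -sqrtr_sqr ler_sqrt //.
rewrite -lecR l2_sqr (le_trans (real_ler_norm _)) //.
  by rewrite -l2_sqr complex_real.
rewrite hdot_star (kmulA algK); apply: (le_trans (hdot_le _ _)); rewrite lecR.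
rewrite -[leRHS]mul1r ler_pM ?l2_ge0 //; exact: opnorm_ub.
Qed.

(** The square of the norm of [x] is at most the product of the norms of [x^*]
    and [x]; divide by the latter. *)
Lemma opnorm_star_le x : opnorm x <= opnorm (kstar x).
Proof.
have [->|x_neq0] := eqVneq (opnorm x) 0; first exact: opnorm_ge0.
have x_gt0 : 0 < opnorm x by rewrite lt_neqAle eq_sym x_neq0 opnorm_ge0.
by rewrite -(ler_pM2r x_gt0) -expr2 (le_trans (opnorm_sqr_le x)) ?opnormM.
Qed.

Lemma opnorm_cstar : is_cstar_norm opnorm.
Proof.
split.
- move=> x x0; rewrite -[x](kmulx1 algK); apply: l2_eq0; apply/eqP.
  by rewrite eq_le l2_ge0 andbT (le_trans (opnormP _ _)) // x0 mul0r.
- move=> x y; apply: opnorm_least => z z1; rewrite (linD (kmul_linear_l algK z)).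
  by rewrite (le_trans (l2D _ _)) // lerD ?opnorm_ub.
- move=> c x; rewrite -normcC -rmorphM; congr (_%:C%C).
  apply/eqP; rewrite eq_le opnormZ_le /=.
  have [->|c_neq0] := eqVneq c 0; first by rewrite normc0 mul0r opnorm_ge0.
  have c_gt0 : 0 < normc c by rewrite -ltcR normcC normr_gt0.
  rewrite -ler_pdivlMl // -normcV -{1}[x]scale1r -(mulVf c_neq0) -scalerA.
  exact: opnormZ_le.
- exact: opnormM.
- move=> x; apply/eqP; rewrite eq_le opnorm_sqr_le andbT.
  rewrite (le_trans (opnormM _ _)) // expr2 ler_wpM2r ?opnorm_ge0 //.
  by rewrite -{2}[x](kstarK algK) opnorm_star_le.
Qed.

End OperatorNorm.

(** * Group algebras *)

Section GroupAlgebra.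
Variables (R : realType) (gT : finGroupType).
Implicit Types (x y z : vec R gT) (g h k : gT) (c : R[i]).
Local Notation lam := (lambda R).

Lemma gmulE x y k : gmul x y k = \sum_g x g * y (g^-1 * k)%g.
Proof.
rewrite /gmul vec_sum; apply: eq_bigr => g _; rewrite vec_sum.
rewrite -(sum_delta (g^-1 * k)%g (fun h => x g * y h)); apply: eq_bigr => h _.
by rewrite vecZ ebaseE mulrC -(inj_eq (mulgI g) h) mulKVg eq_sym.
Qed.

Lemma gstarE x g : gstar x g = (x g^-1%g : R[i])^*.
Proof.
rewrite /gstar vec_sum -(sum_delta g^-1%g (fun h => (x h : R[i])^*)).
apply: eq_bigr => h _; rewrite vecZ ebaseE mulrC.
by rewrite -(inj_eq invg_inj h) invgK eq_sym.
Qed.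

Lemma gantipodeE x g : gantipode x g = x g^-1%g.
Proof.
rewrite /gantipode vec_sum -(sum_delta g^-1%g (fun h => x h)).
apply: eq_bigr => h _; rewrite vecZ ebaseE mulrC.
by rewrite -(inj_eq invg_inj h) invgK eq_sym.
Qed.

Lemma gmul_linear_l y : linear (fun x => gmul x y).
Proof.
move=> c x x'; apply/ffunP => k; rewrite [LHS]gmulE [RHS]vecD [in RHS]vecZ.
rewrite (gmulE x y) (gmulE x' y) mulr_sumr -big_split.
by apply: eq_bigr => g _; rewrite vecD vecZ mulrDl mulrA.
Qed.

Lemma gmul_linear_r x : linear (gmul x).
Proof.
move=> c y y'; rewrite /gmul scaler_sumr -big_split.
apply: eq_bigr => g _ /=; rewrite scaler_sumr -big_split.
apply: eq_bigr => h _ /=.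
by rewrite vecD vecZ mulrDr scalerDl scalerA mulrCA.
Qed.

Lemma gmul_suml I (r : seq I) (P : pred I) (E : I -> vec R gT) y :
  gmul (\sum_(i <- r | P i) E i) y = \sum_(i <- r | P i) gmul (E i) y.
Proof. exact: (lin_sum (gmul_linear_l y)). Qed.

Lemma gmul_sumr I (r : seq I) (P : pred I) (E : I -> vec R gT) x :
  gmul x (\sum_(i <- r | P i) E i) = \sum_(i <- r | P i) gmul x (E i).
Proof. exact: (lin_sum (gmul_linear_r x)). Qed.

Lemma gmulZl c x y : gmul (c *: x) y = c *: gmul x y.
Proof. exact: (linZ (gmul_linear_l y)). Qed.

Lemma gmulZr c x y : gmul x (c *: y) = c *: gmul x y.
Proof. exact: (linZ (gmul_linear_r x)). Qed.

Lemma gmul_lambda g h : gmul (lam g) (lam h) = lam (g * h)%g.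
Proof.
apply/ffunP => k; rewrite gmulE ebaseE.
rewrite -(sum_delta g (fun g' => (k == g' * h)%g%:R)).
by apply: eq_bigr => g' _; rewrite !ebaseE -(inj_eq (mulgI g') _ h) mulKVg.
Qed.

Lemma gmul_combination (I J : finType) (u : I -> R[i]) (v : J -> R[i])
    (k : I -> gT) (l : J -> gT) :
  gmul (\sum_i u i *: lam (k i)) (\sum_j v j *: lam (l j)) =
  \sum_i \sum_j (u i * v j) *: lam (k i * l j)%g.
Proof.
rewrite gmul_suml; apply: eq_bigr => i _.
rewrite gmulZl gmul_sumr scaler_sumr; apply: eq_bigr => j _.
by rewrite gmulZr gmul_lambda scalerA.
Qed.

Lemma gmulA x y z : gmul x (gmul y z) = gmul (gmul x y) z.
Proof.
apply/ffunP => k; rewrite !gmulE.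
under [RHS]eq_bigr do rewrite gmulE mulr_suml.
rewrite exchange_big; apply: eq_bigr => g _ /=; rewrite gmulE mulr_sumr.
rewrite [RHS](reindex_inj (mulgI g)); apply: eq_bigr => h _ /=.
by rewrite mulKg invMg !mulgA mulrA.
Qed.

Lemma gmul1x x : gmul (lam 1%g) x = x.
Proof.
apply/ffunP => k; rewrite gmulE -[RHS](sum_delta (1%g : gT) (fun _ => x k)).
apply: eq_bigr => g _; rewrite ebaseE.
by case: eqP => [->|_]; rewrite ?invg1 ?mul1g ?mul0r.
Qed.

Lemma gmulx1 x : gmul x (lam 1%g) = x.
Proof.
apply/ffunP => k; rewrite gmulE -(sum_delta k (fun g => x g)).
apply: eq_bigr => g _; rewrite ebaseE mulrC.
by rewrite -(inj_eq (mulgI g)) mulKVg mulg1 eq_sym.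
Qed.

(** Conjugation by a unitary is multiplicative: the product [w'] [w] in the
    middle cancels. *)
Lemma gmul_conjugate (w w' x y : vec R gT) : gmul w' w = lam 1%g ->
  gmul (gmul w (gmul x y)) w' = gmul (gmul (gmul w x) w') (gmul (gmul w y) w').
Proof.
move=> ww; rewrite -(gmulA (gmul w x) w' (gmul (gmul w y) w')).
rewrite (gmulA w' (gmul w y) w') (gmulA w' w y) ww (gmul1x y).
by rewrite (gmulA w x y) (gmulA (gmul w x) y w').
Qed.

Lemma gstar_antilinear c x y : gstar (c *: x + y) = c^* *: gstar x + gstar y.
Proof.
apply/ffunP => g; rewrite vecD vecZ !gstarE vecD vecZ.
by rewrite rmorphD rmorphM.
Qed.

Lemma gstar_lambda g : gstar (lam g) = lam g^-1%g.
Proof.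
apply/ffunP => h; rewrite gstarE !ebaseE conjC_nat.
by rewrite -[h == _](inj_eq invg_inj) invgK.
Qed.

Lemma gstarK x : gstar (gstar x) = x.
Proof. by apply/ffunP => g; rewrite !gstarE invgK conjCK. Qed.

Lemma gstarM x y : gstar (gmul x y) = gmul (gstar y) (gstar x).
Proof.
apply/ffunP => k; rewrite gstarE !gmulE rmorph_sum.
rewrite [RHS](reindex_inj (mulgI k)); apply: eq_bigr => g _.
by rewrite rmorphM !gstarE !invMg !invgK mulKg mulrC.
Qed.

Lemma gantipode_linear : linear (@gantipode R gT).
Proof.
by move=> c x y; apply/ffunP => g; rewrite vecD vecZ !gantipodeE vecD vecZ.
Qed.

Lemma gantipode_lambda g : gantipode (lam g) = lam g^-1%g.
Proof.
apply/ffunP => h; rewrite gantipodeE !ebaseE.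
by rewrite -[h == _](inj_eq invg_inj) invgK.
Qed.

Lemma gantipodeM x y : gantipode (gmul x y) = gmul (gantipode y) (gantipode x).
Proof.
apply/ffunP => k; rewrite gantipodeE !gmulE.
rewrite [RHS](reindex_inj (mulgI k)); apply: eq_bigr => g _.
by rewrite !gantipodeE !invMg !invgK mulKg mulrC.
Qed.

Lemma gcounit_linear : linear (@gcounit R gT).
Proof.
move=> c x y; rewrite /gcounit scaler_sumr -big_split.
by apply: eq_bigr => g _; rewrite vecD vecZ.
Qed.

Lemma gcounit_lambda g : gcounit (lam g) = 1.
Proof.
rewrite /gcounit -[RHS](sum_delta g (fun=> 1)).
by apply: eq_bigr => h _; rewrite ebaseE mulr1.
Qed.

Lemma gcounitM x y : gcounit (gmul x y) = gcounit x * gcounit y.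
Proof.
rewrite /gcounit mulr_suml; under eq_bigr do rewrite gmulE.
rewrite exchange_big; apply: eq_bigr => g _ /=; rewrite mulr_sumr.
by rewrite (reindex_inj (mulgI g)); apply: eq_bigr => h _; rewrite mulKg.
Qed.

(** Left translations permute the orthonormal basis, so they are unitary, and
    [gstar] is the adjoint. *)
Lemma gmul_hdot x y z : hdot (gmul x y) z = hdot y (gmul (gstar x) z).
Proof.
rewrite /hdot; under eq_bigr do rewrite gmulE mulr_suml.
under [RHS]eq_bigr do rewrite gmulE rmorph_sum mulr_sumr.
rewrite exchange_big [RHS]exchange_big [RHS](reindex_inj invg_inj) /=.
apply: eq_bigr => g _; rewrite (reindex_inj (mulgI g)); apply: eq_bigr => h _ /=.
by rewrite gstarE rmorphM /= conjCK invgK mulKg mulrA [y h * _]mulrC.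
Qed.

End GroupAlgebra.

Section ProductGroup.
Variables (R : realType) (gT : finGroupType).
Implicit Types (X Y : vec R (gT * gT)%type).

(** The tensor square of a group algebra is the group algebra of the product
    group, so that the results above apply to [Omega] as well. *)
Lemma tmul_gmul X Y : tmul (@gmul R gT) X Y = gmul X Y.
Proof.
apply: eq_bigr => p _; apply: eq_bigr => q _; congr (_ *: _).
transitivity (tensor (lambda R (p.1 * q.1)%g) (lambda R (p.2 * q.2)%g)).
  by congr tensor; apply: gmul_lambda.
exact/esym/(ebase_pair R (p * q)%g).
Qed.

Lemma tstar_gstar X : tstar (@gstar R gT) X = gstar X.
Proof.
apply: eq_bigr => p _; congr (_ *: _).
transitivity (tensor (lambda R p.1^-1%g) (lambda R p.2^-1%g)).
  by congr tensor; apply: gstar_lambda.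
exact/esym/(ebase_pair R p^-1%g).
Qed.

End ProductGroup.

(** * The twist on the Klein four-group *)

Section Klein.
Variable R : realType.
Local Notation V := (bool * bool)%type.
Local Notation i := ('i%C : R[i]).

(** The Klein group {1, a^n, b, b a^n}, written additively: (s, t) stands for
    b^s a^(n t). *)
Definition kadd (u v : V) : V := (u.1 (+) v.1, u.2 (+) v.2).

Lemma kaddC u v : kadd u v = kadd v u.
Proof. by rewrite /kadd addbC [u.2 (+) _]addbC. Qed.

Lemma kaddKK u v : kadd (kadd u v) v = u.
Proof. by rewrite /kadd -!addbA !addbb !addbF -surjective_pairing. Qed.

Lemma sum_klein (A : nmodType) (F : V -> A) :
  \sum_u F u = F (false, false) + F (false, true) + (F (true, false) + F (true, true)).
Proof.
transitivity (\sum_s \sum_t F (s, t)).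
  by rewrite pair_bigA; apply: eq_bigr => -[].
rewrite !big_bool /= addrC.
by rewrite [X in X + _]addrC [X in _ + X]addrC.
Qed.

Lemma sum_shift (A : nmodType) (E : V * V -> V * V -> A) :
  \sum_p \sum_q E p q =
  \sum_m \sum_q E (kadd m.1 q.1, kadd m.2 q.2) q.
Proof.
pose shift (q m : V * V) := (kadd m.1 q.1, kadd m.2 q.2).
have shiftK q : involutive (shift q).
  by case=> m1 m2; rewrite /shift /= !kaddKK.
rewrite exchange_big /=.
under eq_bigr => q _ do rewrite (reindex_inj (inv_inj (shiftK q))).
exact: exchange_big.
Qed.

(** The coefficients of [Omega], indexed by pairs of bits; the entries
    2 i - 1 and - 2 i - 1 are nu and its conjugate. *)
Definition twist_coef (u v : V) : R[i] :=
  let rank (w : V) := match w with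
    | (false, false) => 0 | (false, true) => 1 | (true, false) => 2 | _ => 3
  end%N in
  8^-1 * nth 0 (nth [::]
    [:: [:: 5; 1;             1;             1            ];
        [:: 1; 1;             - (2 * i) - 1; 2 * i - 1    ];
        [:: 1; 2 * i - 1;     1;             - (2 * i) - 1];
        [:: 1; - (2 * i) - 1; 2 * i - 1;     1            ]] (rank u)) (rank v).

(** The matrix is hermitian, so conjugation can be replaced by transposition. *)
Lemma twist_coef_conj u v : (twist_coef u v)^* = twist_coef v u.
Proof.
have conji : i^* = - i.
  by apply/eqP; rewrite eq_complex /= !oppr0 !eqxx.
rewrite /twist_coef rmorphM fmorphV /= conjC_nat; congr (_ * _).
have conjnu : (2 * i - 1)^* = - (2 * i) - 1.
  by rewrite rmorphB rmorphM /= conji conjC_nat conjC1 mulrN.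
have conjnu' : (- (2 * i) - 1)^* = 2 * i - 1.
  by rewrite rmorphB rmorphN rmorphM /= conji conjC_nat conjC1 mulrN opprK.
by case: u v => [[] []] [[] []] /=; rewrite ?conjC_nat ?conjC1.
Qed.

(** The sign by which b^s c^t, for c central, fails to commute with the odd part
    r - r^-1 of a rotation r; it commutes with the even part r + r^-1. *)
Definition flip_sign (u : V) : R[i] := (-1) ^+ u.1.

(** Let f be the automorphism of the algebra of the Klein group that changes
    the sign of b, and let Omega' be the adjoint of Omega.  These are the
    coefficients of the product of Omega and (f^e (x) f^e')(Omega').  They occur
    when the factors of Omega' move past even (e = 0) or odd (e = 1) parts of
    rotations. *)
Definition flip_coef (e e' : bool) (m : V * V) : R[i] := \sum_(q : V * V)
  twist_coef (kadd m.1 q.1) (kadd m.2 q.2) * (twist_coef q.1 q.2)^* *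
  (flip_sign q.1 ^+ e * flip_sign q.2 ^+ e').

Definition flip_table (e e' : bool) (m : V * V) : R[i] :=
  let rank (w : V) := match w with
    | (false, false) => 0 | (false, true) => 1 | (true, false) => 2 | _ => 3
  end%N in
  4^-1 * nth 0 (nth [::] match e, e' with
   | false, false =>
    [:: [:: 4; 0; 0; 0]; [:: 0; 0; 0; 0]; [:: 0; 0; 0; 0]; [:: 0; 0; 0; 0]]
   | false, true =>
    [:: [:: 1; 1; i; - i]; [:: 1; 1; - i; i];
        [:: 1; -1; - i; - i]; [:: 1; -1; i; i]]
   | true, false =>
    [:: [:: 1; 1; 1; 1]; [:: 1; 1; -1; -1];
        [:: - i; i; i; - i]; [:: i; - i; i; - i]]
   | true, true =>
    [:: [:: 1; 1; - i; i]; [:: 1; 1; - i; i];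
        [:: i; i; 1; -1]; [:: - i; - i; -1; 1]]
  end (rank m.1)) (rank m.2).

Lemma sum_klein2 (A : nmodType) (F : V * V -> A) :
  \sum_p F p = \sum_u \sum_v F (u, v).
Proof. by rewrite pair_bigA; apply: eq_bigr => -[]. Qed.

Lemma flip_coefE e e' m : flip_coef e e' m = flip_table e e' m.
Proof.
have ii : i * i = -1 by rewrite -expr2 sqr_i.
rewrite /flip_coef; under eq_bigr do rewrite twist_coef_conj.
rewrite sum_klein2 !sum_klein /flip_table /twist_coef /flip_sign /kadd.
by case: e e' m => [] [] [[[] []] [[] []]] /=; field: ii.
Qed.

(** A symmetric nondegenerate bicharacter of the Klein group: the factor of the
    even part of the self-pairing. *)
Definition kchi (u v : V) : R[i] := (-1) ^+ ((u.1 && v.2) (+) (u.2 && v.1)).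

(** The factor of the odd part of the self-pairing: up to scalars, a permutation
    matrix that pairs each u with exactly one v. *)
Definition ksigma (u v : V) : R[i] :=
  match u.1, v.1 with
  | false, false => if u.2 == v.2 then 0 else 2
  | true, true => if u.2 == v.2 then (-1) ^+ u.2 * - (2 * i) else 0
  | _, _ => 0
  end.

(** The entry of the self-pairing at two group elements whose classes modulo the
    rotations of order n are u and v, where x and y stand for zcos(j k) and
    zsin(j k). *)
Definition kform (u v : V) (x y : R[i]) := kchi u v * x + ksigma u v * y.

Lemma kformC u v x y : kform u v x y = kform v u x y.
Proof. by case: u v => [[] []] [[] []]. Qed.

Lemma kform_conj u v x y : x^* = x -> y^* = - y ->
  (kform u v x y)^* = kform u v x ((-1) ^+ (~~ u.1) * y).
Proof.
move=> xJ yJ; have conji : i^* = - i.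
  by apply/eqP; rewrite eq_complex /= !oppr0 !eqxx.
rewrite /kform rmorphD !rmorphM /= xJ yJ rmorph_sign; congr (_ + _).
case: u v => [[] []] [[] []]; rewrite /ksigma /= ?conjC0 ?conjC_nat;
  rewrite ?rmorphM ?rmorphN ?rmorphM /= ?conjC_nat ?conji ?conjC1; ring.
Qed.

(** The even part picks out the trivial character. *)
Lemma sum_kform u x y : \sum_v kform u v x y =
  (u == (false, false))%:R * (4 * x) + \sum_v ksigma u v * y.
Proof.
rewrite /kform big_split -!mulr_suml; congr (_ + _).
by rewrite sum_klein /kchi; case: u => [[] []] /=; ring.
Qed.

(** The multiplicativity of psi, with all rotations replaced by the four unknowns
    x, y, x', y'.  Collecting the Klein factors p of Omega and q of its adjoint
    into m = p + q leaves the sums [flip_coef], one for each choice of even or odd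
    parts.  The right-hand side is what the addition formulas of zcos and zsin
    produce. *)
Lemma kform_convolution u u' v x y x' y' :
  \sum_(p : V * V) \sum_(q : V * V)
    twist_coef p.1 p.2 * (twist_coef q.1 q.2)^* *
    (kform u (kadd (kadd p.1 v) q.1) x (flip_sign q.1 * y) *
     kform u' (kadd (kadd p.2 v) q.2) x' (flip_sign q.2 * y')) =
  kform (kadd u u') v (x * x' + flip_sign u' * (y * y'))
    (x * y' + flip_sign u' * (y * x')).
Proof.
have ii : i * i = -1 by rewrite -expr2 sqr_i.
transitivity (\sum_(m : V * V)
  (flip_coef false false m * (kchi u (kadd m.1 v) * x) * (kchi u' (kadd m.2 v) * x') +
   flip_coef false true m * (kchi u (kadd m.1 v) * x) * (ksigma u' (kadd m.2 v) * y') +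
   flip_coef true false m * (ksigma u (kadd m.1 v) * y) * (kchi u' (kadd m.2 v) * x') +
   flip_coef true true m * (ksigma u (kadd m.1 v) * y) *
     (ksigma u' (kadd m.2 v) * y'))).
  rewrite sum_shift; apply: eq_bigr => m _ /=.
  rewrite /flip_coef !mulr_suml -!big_split /=; apply: eq_bigr => q _.
  have kaddAC w z : kadd (kadd (kadd w z) v) z = kadd w v.
    by case: w z v => [[] []] [[] []] [[] []].
  by rewrite !kaddAC /kform !expr0 !expr1; ring.
rewrite sum_klein2 !sum_klein !flip_coefE.
rewrite /flip_table /kform /kchi /ksigma /flip_sign /kadd.
by case: u u' v => [[] []] [[] []] [[] []] /=; field: ii.
Qed.

(** Multiplying the two legs of [Omega] together gives 1. *)
Lemma twist_coef_diag m :
  \sum_u twist_coef (kadd m u) u = (m == (false, false))%:R.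
Proof.
have ii : i * i = -1 by rewrite -expr2 sqr_i.
rewrite sum_klein /twist_coef /kadd.
by case: m => [[] []] /=; field: ii.
Qed.

(** The unitarity of [Omega], in coordinates. *)
Lemma flip_coef_unit m :
  flip_coef false false m = (m == ((false, false), (false, false)))%:R.
Proof.
rewrite flip_coefE /flip_table.
by case: m => [[[] []] [[] []]] /=; field.
Qed.

End Klein.

(** * Roots of unity *)

(** The exponent of a after a^i has moved past b^t, that is, plus or minus i
    modulo 2 n: a^i b^t = b^t a^(turn n t i).  Exponents are kept natural, with
    (2 n).-1 for -1. *)
Definition turn (n : nat) (t : bool) (i : nat) : nat :=
  (if t then (2 * n).-1 * i else i)%N.

Lemma turnD n t i j : turn n t (i + j) = (turn n t i + turn n t j)%N.
Proof. by rewrite /turn; case: t; rewrite ?mulnDr. Qed.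

Lemma turn_mul n t m i : turn n t (m * i) = (m * turn n t i)%N.
Proof. by rewrite /turn; case: t; rewrite 1?mulnCA. Qed.

Lemma turn_mulr n t i m : turn n t (i * m) = (turn n t i * m)%N.
Proof. by rewrite mulnC turn_mul mulnC. Qed.

Lemma odd_turn n t i : odd n -> odd (turn n t i) = odd i.
Proof.
case: t => // n_odd; rewrite /turn oddM.
by case: n n_odd => // m _; rewrite mulnS /= oddM.
Qed.

Section RootOfUnity.
Variables (R : realType) (n : nat).
Hypothesis n_odd : odd n.
Local Notation eps := (eps R n).

Let n_gt0 : (0 < n)%N. Proof. exact: odd_gt0. Qed.

Lemma epsX m :
  eps ^+ m = (cos (m%:R * (pi / n%:R)) +i* sin (m%:R * (pi / n%:R)))%C.
Proof.
rewrite /Defs.eps; move: (pi / n%:R) => t.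
elim: m => [|m IHm]; first by rewrite mul0r cos0 sin0.
rewrite exprS IHm -natr1 mulrDl mul1r addrC cosD sinD.
by apply/eqP; rewrite eq_complex /= [sin t * _ + _]addrC !eqxx.
Qed.

Lemma epsXn : eps ^+ n = -1.
Proof.
rewrite epsX mulrC mulfVK ?pnatr_eq0 -?lt0n // cospi sinpi.
by apply/eqP; rewrite eq_complex /= oppr0 !eqxx.
Qed.

Lemma eps_neq0 : eps != 0.
Proof.
apply: contraTneq n_gt0 => e0; have /eqP := epsXn.
by rewrite e0 expr0n; case: n => // m; rewrite eq_sym oppr_eq0 oner_eq0.
Qed.

Lemma conj_eps : eps^* = eps^-1.
Proof.
apply: (mulIf eps_neq0); rewrite mulVf ?eps_neq0 // mulrC.
rewrite /Defs.eps; move: (pi / n%:R) => t; apply/eqP.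
rewrite eq_complex /=; apply/andP; split; apply/eqP; last by ring.
by rewrite -(cos2Dsin2 t); ring.
Qed.

(** The imaginary part of eps^r is positive for 0 < r < n and eps^n = -1, so no
    smaller positive power than the (2 n)-th is 1. *)
Lemma epsX_eq1 m : (eps ^+ m == 1) = (2 * n %| m)%N.
Proof.
have sin_gt0 r : (0 < r < n)%N -> 0 < complex.Im (eps ^+ r).
  case/andP=> r_gt0 r_lt; rewrite epsX /=; apply: sin_gt0_pi.
  apply/andP; split.
    by apply: mulr_gt0; last apply: divr_gt0; rewrite ?ltr0n ?pi_gt0.
  rewrite (mulrCA r%:R) gtr_pMr ?pi_gt0 // ltr_pdivrMr ?ltr0n //.
  by rewrite mul1r ltr_nat.
have epsX2n : eps ^+ (2 * n) = 1 by rewrite mulnC exprM epsXn sqrrN expr1n.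
apply/idP/idP => [/eqP eps_m|/dvdnP [q ->]]; last first.
  by rewrite mulnC exprM epsX2n expr1n.
have : eps ^+ (m %% (2 * n)) = 1.
  by move: eps_m; rewrite {1}(divn_eq m (2 * n)) exprD mulnC exprM epsX2n expr1n mul1r.
have : (m %% (2 * n) < 2 * n)%N by rewrite ltn_mod muln_gt0.
rewrite /dvdn; move: (m %% _)%N => r r_lt er1.
have [//|r_gt0] := posnP r.
have [r_lt_n|n_lt_r|r_n] := ltngtP r n.
- by have := sin_gt0 r; rewrite r_gt0 r_lt_n er1 /= ltxx => /(_ isT).
- have /sin_gt0 : (0 < r - n < n)%N by lia.
  have := er1; rewrite -{1}(subnK (ltnW n_lt_r)) exprD epsXn mulrN1 => /eqP.
  by rewrite eqr_oppLR => /eqP ->; rewrite /= oppr0 ltxx.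
- have /eqP := epsXn; rewrite r_n in er1.
  by rewrite er1 -addr_eq0 -[1 + 1]/(2%:R) pnatr_eq0.
Qed.

(** For n odd, -eps is an n-th root of unity, since eps^n = -1. *)
Definition zeta : R[i] := - eps.

Lemma zetaXn : zeta ^+ n = 1.
Proof. by rewrite /zeta exprNn epsXn -signr_odd n_odd expr1 mulrNN mulr1. Qed.

Lemma zeta_neq0 : zeta != 0.
Proof. by rewrite oppr_eq0 eps_neq0. Qed.

Lemma conj_zeta : zeta^* = zeta^-1.
Proof. by rewrite rmorphN /= conj_eps invrN. Qed.

(** The complex numbers cos(m t) and i sin(m t), for t the argument of [zeta]. *)
Definition zcos m : R[i] := (zeta ^+ m + zeta ^- m) / 2.
Definition zsin m : R[i] := (zeta ^+ m - zeta ^- m) / 2.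

Lemma zcos0 : zcos 0 = 1.
Proof. by rewrite /zcos invr1 -[1 + 1]/(2%:R) divff ?pnatr_eq0. Qed.

Lemma zsin0 : zsin 0 = 0.
Proof. by rewrite /zsin invr1 subrr mul0r. Qed.

Lemma zetaX_mod m m' : m = m' %[mod n] -> zeta ^+ m = zeta ^+ m'.
Proof. by move=> mm'; rewrite -(expr_mod m zetaXn) mm' expr_mod // zetaXn. Qed.

Lemma zcos_mod m m' : m = m' %[mod n] -> zcos m = zcos m'.
Proof. by move=> mm'; rewrite /zcos (zetaX_mod mm'). Qed.

Lemma zsin_mod m m' : m = m' %[mod n] -> zsin m = zsin m'.
Proof. by move=> mm'; rewrite /zsin (zetaX_mod mm'). Qed.

Lemma zetaX_turn t m : zeta ^+ turn n t m = if t then zeta ^- m else zeta ^+ m.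
Proof.
case: t => //; rewrite /turn.
apply: (mulIf (expf_neq0 m zeta_neq0)); rewrite mulVf ?expf_neq0 ?zeta_neq0 //.
rewrite -exprD -[X in (_ + X)%N]mul1n -mulnDl addn1 prednK ?muln_gt0 //.
by rewrite -mulnA mulnCA exprM zetaXn expr1n.
Qed.

Lemma zcos_turn t m : zcos (turn n t m) = zcos m.
Proof. by rewrite /zcos zetaX_turn; case: t; rewrite // invrK addrC. Qed.

Lemma zsin_turn t m : zsin (turn n t m) = (-1) ^+ t * zsin m.
Proof.
rewrite /zsin zetaX_turn; case: t; rewrite ?mul1r // invrK mulN1r.
by rewrite -opprB mulNr.
Qed.

Lemma zcos_shift j i e : zcos (j * (i + n * e)) = zcos (j * i).
Proof. by apply: zcos_mod; rewrite mulnDr mulnCA addnC mulnC modnMDl. Qed.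

Lemma zsin_shift j i e : zsin (j * (i + n * e)) = zsin (j * i).
Proof. by apply: zsin_mod; rewrite mulnDr mulnCA addnC mulnC modnMDl. Qed.

Lemma zcosD m m' : zcos (m + m') = zcos m * zcos m' + zsin m * zsin m'.
Proof.
rewrite /zcos /zsin exprD.
by field; rewrite !expf_neq0 ?zeta_neq0.
Qed.

Lemma zsinD m m' : zsin (m + m') = zcos m * zsin m' + zsin m * zcos m'.
Proof.
rewrite /zcos /zsin exprD.
by field; rewrite !expf_neq0 ?zeta_neq0.
Qed.

Lemma conj_zcos m : (zcos m)^* = zcos m.
Proof.
rewrite /zcos rmorphM rmorphD !fmorphV !rmorphXn /= conj_zeta conjC_nat.
by rewrite exprVn invrK addrC.
Qed.

Lemma conj_zsin m : (zsin m)^* = - zsin m.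
Proof.
rewrite /zsin rmorphM rmorphB !fmorphV !rmorphXn /= conj_zeta conjC_nat.
by rewrite exprVn invrK -opprB mulNr.
Qed.

(** A geometric sum whose ratio is an n-th root of unity. *)
Lemma sum_zetaX j : \sum_(k < n) zeta ^+ (j * k) = (zeta ^+ j == 1)%:R * n%:R.
Proof.
under eq_bigr do rewrite exprM.
have [->|zj] := eqVneq.
  by under eq_bigr do rewrite expr1n; rewrite sumr_const card_ord mul1r.
have /eqP : (zeta ^+ j - 1) * \sum_(k < n) zeta ^+ j ^+ k = 0.
  by rewrite -subrX1 -exprM mulnC exprM zetaXn expr1n subrr.
by rewrite mulf_eq0 subr_eq0 (negPf zj) mul0r => /eqP.
Qed.

Lemma sum_zetaXV j :
  \sum_(k < n) zeta ^- (j * k) = (zeta ^+ j == 1)%:R * n%:R.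
Proof.
transitivity ((\sum_(k < n) zeta ^+ (j * k))^*).
  rewrite rmorph_sum; apply: eq_bigr => k _.
  by rewrite rmorphXn /= conj_zeta exprVn.
by rewrite sum_zetaX rmorphM /= !conjC_nat.
Qed.

Lemma sum_zcos j : \sum_(k < n) zcos (j * k) = (zeta ^+ j == 1)%:R * n%:R.
Proof.
rewrite /zcos -mulr_suml big_split /= sum_zetaX sum_zetaXV.
by field.
Qed.

Lemma sum_zsin j : \sum_(k < n) zsin (j * k) = 0.
Proof. by rewrite /zsin -mulr_suml sumrB sum_zetaX sum_zetaXV subrr mul0r. Qed.

End RootOfUnity.

(** * The dihedral group *)

Section Dihedral.
Variables (n : nat) (gT : finGroupType) (a b : gT).
Hypotheses (n_odd : odd n) (dihD : is_dihedral n a b).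

Let n_gt0 : (0 < n)%N. Proof. exact: odd_gt0. Qed.

(** The exponent is an arbitrary natural number, taken modulo 2 n
    ([dih_mod]), so that products need no reduction. *)
Definition dih (s : bool) (k : nat) : gT := (b ^+ s * a ^+ k)%g.

Let aX2n : (a ^+ (2 * n) = 1)%g. Proof. by case: dihD. Qed.
Let bb : (b * b = 1)%g. Proof. by case: dihD. Qed.

Lemma aV : (a^-1 = a ^+ (2 * n).-1)%g.
Proof.
by apply/eqP; rewrite eq_invg_mul -expgS prednK ?muln_gt0 // aX2n.
Qed.

Lemma aXb k : (a ^+ k * b = b * a ^+ ((2 * n).-1 * k))%g.
Proof.
have ab : (a * b = b * a^-1)%g.
  case: dihD => _ _ ba _ _.
  by apply: (mulgI b); rewrite !mulgA bb ba mul1g -mulgA bb mulg1.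
rewrite expgM -aV; elim: k => [|k IHk]; first by rewrite !expg0 mul1g mulg1.
by rewrite !expgS -mulgA IHk mulgA ab mulgA.
Qed.

Lemma dih_mul s j t k :
  (dih s j * dih t k)%g =
  dih (s (+) t) (turn n t j + k).
Proof.
rewrite /turn /dih expgD mulgA -[(b ^+ s * a ^+ j * b ^+ t)%g]mulgA.
case: t => /=; last by rewrite expg0 mulg1 addbF !mulgA.
rewrite expg1 aXb !mulgA addbT.
by case: s; rewrite /= ?expg0 ?expg1 ?bb ?mul1g.
Qed.

Lemma dih_mod s k : dih s (k %% (2 * n)) = dih s k.
Proof. by rewrite /dih expg_mod. Qed.

Lemma dih_inv s j :
  ((dih s j)^-1)%g = dih s (turn n (~~ s) j).
Proof.
apply/eqP; rewrite eq_invg_mul dih_mul addbb /turn /dih expg0 mul1g; apply/eqP.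
case: s => /=; last rewrite addnC.
all: by rewrite -mulSnr prednK ?muln_gt0 // expgM aX2n expg1n.
Qed.

Lemma dih_surj g : exists s k, g = dih s k.
Proof.
pose D := [set dih p.1 p.2 | p : bool * 'I_(2 * n)].
have inD s k : dih s k \in D.
  rewrite -dih_mod; have kn : (k %% (2 * n) < 2 * n)%N by rewrite ltn_mod muln_gt0.
  by apply/imsetP; exists (s, Ordinal kn).
have groupD : group_set D.
  apply/group_setP; split=> [|_ _ /imsetP[[s j] _ ->] /imsetP[[t k] _ ->]].
    by have := inD false 0; rewrite /dih !expg0 mul1g.
  by rewrite dih_mul inD.
have : g \in Group groupD.
  suff /fintype.subsetP/(_ g) : (<<[set a; b]>> \subset Group groupD)%g.
    by apply; case: dihD => _ _ _ ->; rewrite inE.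
  rewrite gen_subG; apply/fintype.subsetP => _ /set2P[] ->.
    by have := inD false 1; rewrite /dih expg0 mul1g expg1.
  by have := inD true 0; rewrite /dih expg0 mulg1 expg1.
by case/imsetP=> [[s k] _ ->]; exists s, k.
Qed.

Definition dih_ord (p : bool * 'I_(2 * n)) : gT := dih p.1 p.2.

(** The map is onto because its image is a subgroup containing a and b, hence
    bijective because #|gT| = 4 n. *)
Lemma dih_ord_bij : bijective dih_ord.
Proof.
have dom_card : #|{: bool * 'I_(2 * n)}| = #|gT|.
  by rewrite card_prod card_bool card_ord; case: dihD => _ _ _ _ ->; rewrite mulnA.
apply: inj_card_bij; last by rewrite dom_card.
have /imset_injP inj : #|[set dih_ord p | p in {: bool * 'I_(2 * n)}]| ==
    #|{: bool * 'I_(2 * n)}|.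
  rewrite dom_card -cardsT; apply/eqP/eq_card => g; rewrite inE.
  have [s [k ->]] := dih_surj g; rewrite -dih_mod.
  have kn : (k %% (2 * n) < 2 * n)%N by rewrite ltn_mod muln_gt0.
  by apply/imsetP; exists (s, Ordinal kn).
by move=> p q; apply: inj.
Qed.

Lemma dih_inj s t j k :
  dih s j = dih t k -> s = t /\ j = k %[mod 2 * n].
Proof.
have lt_mod i : (i %% (2 * n) < 2 * n)%N by rewrite ltn_mod muln_gt0.
rewrite -dih_mod -[RHS]dih_mod => eq_jk.
have : dih_ord (s, Ordinal (lt_mod j)) = dih_ord (t, Ordinal (lt_mod k)) by [].
by move/(bij_inj dih_ord_bij) => [-> ->].
Qed.

End Dihedral.

(** * The twisted coproduct *)

Section Twist.
Variable R : realType.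
Variables (n : nat) (gT : finGroupType) (a b : gT).
Hypotheses (n_odd : odd n) (dihD : is_dihedral n a b).
Local Notation V := (bool * bool)%type.
Local Notation lam := (lambda R).
Local Notation coef p := (twist_coef R p.1 p.2).
Local Notation Om := (Omega R n a b).

Definition kelt (u : V) : gT := dih a b u.1 (n * u.2).
Definition kelt2 (p : V * V) : gT * gT := (kelt p.1, kelt p.2).

Lemma keltM u v : (kelt u * kelt v)%g = kelt (kadd u v).
Proof.
have muln_odd k : (n * k = n * odd k %[mod 2 * n])%N.
  by rewrite mulnC (mulnC n) -!muln_modl !modn2 oddb.
rewrite /kelt (dih_mul n_odd dihD) -[LHS](dih_mod dihD) -[RHS](dih_mod dihD).
congr dih; set k := (_ + _)%N.
have -> : k = (n * (turn n v.1 u.2 + v.2))%N by rewrite /k turn_mul mulnDr.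
rewrite muln_odd [RHS]muln_odd oddD odd_turn //.
by congr ((_ * nat_of_bool _) %% _)%N; rewrite !oddb.
Qed.

Lemma keltV u : ((kelt u)^-1)%g = kelt u.
Proof.
apply/eqP; rewrite eq_invg_mul keltM; case: u => [s t].
by rewrite /kadd !addbb /kelt muln0 /dih !expg0 mulg1.
Qed.

(** The sums over 'I_4 in [Omega], re-indexed by the two binary digits. *)
Lemma Omega_klein : Om = \sum_p coef p *: lam (kelt2 p).
Proof.
have nuE : nu R = 2 * 'i%C - 1 :> R[i].
  by apply/eqP; rewrite eq_complex; apply/andP; split; apply/eqP => /=; ring.
have conj_nu : (nu R)^* = - (2 * 'i%C) - 1 :> R[i].
  by apply/eqP; rewrite eq_complex; apply/andP; split; apply/eqP => /=; ring.
(* h_1, h_2, h_3, h_4 are numbered 0, 1, 2, 3 here: i = 2 s + t is sent to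
   (s, t). *)
pose r (i : 'I_4) : V := (1 < i, odd i)%N.
have r_bij : bijective r.
  apply: inj_card_bij; last by rewrite card_prod card_bool card_ord.
  move=> i j /eqP; case: i j => [[|[|[|[|i]]]] //= Hi] [[|[|[|[|j]]]] //= Hj] _;
    exact: val_inj.
have coefE i j : omega_coef R i j = twist_coef R (r i) (r j).
  rewrite !mxE /twist_coef conj_nu nuE.
  by case: i j => [[|[|[|[|i]]]] //= Hi] [[|[|[|[|j]]]] //= Hj].
have hE i : omega_h n a b i = kelt (r i).
  rewrite /kelt /dih; case: i => [[|[|[|[|i]]]] //= Hi];
    by rewrite ?muln0 ?muln1 ?expg0 ?expg1 ?mul1g ?mulg1.
rewrite sum_klein2 (reindex r) /=; last exact: onW_bij.
apply: eq_bigr => i _; rewrite [RHS](reindex r) /=; last exact: onW_bij.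
apply: eq_bigr => j _; rewrite coefE !hE.
by congr (_ *: _); exact/esym/(ebase_pair R (_, _)).
Qed.

Lemma gstar_Omega : gstar Om = \sum_p (coef p)^* *: lam (kelt2 p).
Proof.
apply/ffunP => g; rewrite gstarE Omega_klein !vec_sum rmorph_sum.
apply: eq_bigr => p _; rewrite !vecZ rmorphM /= !ebaseE conjC_nat; congr (_ * _%:R).
rewrite -(inj_eq invg_inj) invgK; congr (nat_of_bool (g == _)).
by congr (_, _); apply: keltV.
Qed.

Lemma twist_lambda (x : gT * gT) :
  gmul (gmul Om (lam x)) (gstar Om) =
  \sum_p \sum_q (coef p * (coef q)^*) *: lam (kelt2 p * x * kelt2 q)%g.
Proof.
have -> : gmul Om (lam x) = \sum_p coef p *: lam (kelt2 p * x)%g.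
  rewrite Omega_klein gmul_suml; apply: eq_bigr => p _.
  by rewrite gmulZl gmul_lambda.
by rewrite gstar_Omega gmul_combination.
Qed.

Lemma kelt2M p q :
  (kelt2 p * kelt2 q)%g = kelt2 (kadd p.1 q.1, kadd p.2 q.2).
Proof. by congr (_, _); apply: keltM. Qed.

Lemma kelt0 : kelt (false, false) = 1%g.
Proof. by rewrite /kelt /dih muln0 !expg0 mulg1. Qed.

(** The unitarity of [Omega] in the form in which it is used: only the total
    Klein factor p + q matters, and it contributes 0 alone. *)
Lemma twist_cancel (A : lmodType R[i]) (F : V * V -> A) :
  \sum_p \sum_q (coef p * (coef q)^*) *: F (kadd p.1 q.1, kadd p.2 q.2) =
  F ((false, false), (false, false)).
Proof.
transitivity (\sum_m flip_coef R false false m *: F m).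
  rewrite sum_shift; apply: eq_bigr => m _ /=.
  rewrite /flip_coef scaler_suml; apply: eq_bigr => q _.
  by rewrite !kaddKK mulr1 mulr1 -surjective_pairing.
rewrite (bigD1 (false, false, (false, false))) //= flip_coef_unit eqxx scale1r.
rewrite big1 ?addr0 // => m /negPf nm.
by rewrite flip_coef_unit nm scale0r.
Qed.

Lemma Omega_mul_star : gmul Om (gstar Om) = lam 1%g.
Proof.
rewrite -{1}[Om]gmulx1 twist_lambda.
under eq_bigr do under eq_bigr do rewrite mulg1 kelt2M.
rewrite (twist_cancel (fun m => lam (kelt2 m))) /kelt2 !kelt0.
by [].
Qed.

Lemma star_mul_Omega : gmul (gstar Om) Om = lam 1%g.
Proof.
rewrite -Omega_mul_star gstar_Omega Omega_klein !gmul_combination exchange_big.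
apply: eq_bigr => p _; apply: eq_bigr => q _.
by rewrite !kelt2M (kaddC q.1) (kaddC q.2) mulrC.
Qed.

Lemma Delta_s_linear : linear (@Delta_s R gT : vec R gT -> vec R (gT * gT)%type).
Proof.
move=> c x y; rewrite /Delta_s scaler_sumr -big_split; apply: eq_bigr => g _ /=.
by rewrite vecD vecZ scalerDl scalerA.
Qed.

Lemma Delta_s_lambda (g : gT) : Delta_s (lam g) = lam (g, g).
Proof.
rewrite /Delta_s (sum_ebase g (fun g => tensor (lam g) (lam g))).
exact/esym/(ebase_pair R (g, g)).
Qed.

Lemma Delta_sM (x y : vec R gT) :
  Delta_s (gmul x y) = gmul (Delta_s x) (Delta_s y).
Proof.
apply: (lin_eq (f := fun x => Delta_s (gmul x y))
  (g := fun x => gmul (Delta_s x) (Delta_s y))).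
- by move=> c u v; rewrite gmul_linear_l Delta_s_linear.
- by move=> c u v; rewrite Delta_s_linear gmul_linear_l.
move=> g; apply: (lin_eq (f := fun y => Delta_s (gmul (lam g) y))
  (g := fun y => gmul (Delta_s (lam g)) (Delta_s y))).
- by move=> c u v; rewrite gmul_linear_r Delta_s_linear.
- by move=> c u v; rewrite Delta_s_linear gmul_linear_r.
move=> h; rewrite (gmul_lambda R g h) !Delta_s_lambda.
by rewrite (gmul_lambda R (g, g) (h, h)).
Qed.

Lemma Delta_sE (x : vec R gT) p : Delta_s x p = x p.1 * (p.2 == p.1)%:R.
Proof.
rewrite /Delta_s vec_sum -(sum_delta p.1 (fun g => x g * (p.2 == g)%:R)).
apply: eq_bigr => g _; rewrite vecZ tensorE !ebaseE [p.1 == g]eq_sym.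
by rewrite mulrCA.
Qed.

Lemma Delta_s_star (x : vec R gT) : Delta_s (gstar x) = gstar (Delta_s x).
Proof.
apply/ffunP => p; rewrite gstarE !Delta_sE gstarE rmorphM /= conjC_nat.
by rewrite (inj_eq invg_inj).
Qed.

Local Notation K := (KD R n a b).

Lemma KD_coprodE (x : kspace K) :
  kcoprod x = gmul (gmul Om (Delta_s x)) (gstar Om).
Proof. by rewrite /= /KD_coprod !tmul_gmul tstar_gstar. Qed.

Lemma KD_coprod_lambda (g : gT) :
  KD_coprod n a b (lam g) =
  \sum_p \sum_q (coef p * (coef q)^*) *:
    lam (kelt p.1 * g * kelt q.1, kelt p.2 * g * kelt q.2)%g.
Proof.
by rewrite -[LHS]/(kcoprod (lam g : kspace K)) KD_coprodE Delta_s_lambda twist_lambda.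
Qed.

Lemma KD_coprod_linear : linear (@kcoprod R K).
Proof.
move=> c x y; rewrite !KD_coprodE.
exact: (lin_comp (lin_comp Delta_s_linear (gmul_linear_r Om)) (gmul_linear_l _)).
Qed.

Lemma KD_star_algebra : is_star_algebra K.
Proof.
split; [exact: gmul_linear_l | exact: gmul_linear_r | exact: gmulA |
  exact: gmul1x | exact: gmulx1 | exact: gstar_antilinear | exact: gstarK |
  exact: gstarM].
Qed.

(** [twist_coef_diag], as a rule for sums in which only the product of the two
    legs of [Omega] occurs. *)
Lemma twist_antidiag (A : lmodType R[i]) (F : V -> A) :
  \sum_p coef p *: F (kadd p.1 p.2) = F (false, false).
Proof.
have kadd_inj v : injective (kadd^~ v).
  by apply: (can_inj (g := kadd^~ v)) => u; rewrite kaddKK.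
rewrite sum_klein2 exchange_big /=.
under eq_bigr => v _ do rewrite (reindex_inj (kadd_inj v)).
rewrite exchange_big /=.
transitivity (\sum_m (\sum_v twist_coef R (kadd m v) v) *: F m).
  apply: eq_bigr => m _; rewrite scaler_suml; apply: eq_bigr => v _.
  by rewrite kaddKK.
rewrite (bigD1 (false, false)) //= twist_coef_diag eqxx scale1r.
by rewrite big1 ?addr0 // => m /negPf nm; rewrite twist_coef_diag nm scale0r.
Qed.

Lemma twist_antidiag_conj (A : lmodType R[i]) (F : V -> A) :
  \sum_p (coef p)^* *: F (kadd p.1 p.2) = F (false, false).
Proof.
rewrite -[RHS]twist_antidiag !sum_klein2 exchange_big /=.
apply: eq_bigr => u _; apply: eq_bigr => v _.
by rewrite twist_coef_conj kaddC.
Qed.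

(** Linear functions of a coproduct need only be computed on group elements;
    [F] will be (g, h) |-> g^-1 h and (g, h) |-> g h^-1. *)
Lemma KD_coprod_contract (F : gT * gT -> gT) :
    (forall g, \sum_p \sum_q (coef p * (coef q)^*) *:
      lam (F (kelt p.1 * g * kelt q.1, kelt p.2 * g * kelt q.2))%g = lam 1%g) ->
  forall x : kspace K, \sum_p kcoprod x p *: lam (F p) = kcounit x *: kone K.
Proof.
move=> F_lambda.
pose T (X : vec R (gT * gT)%type) : vec R gT := \sum_p X p *: lam (F p).
have T_lin : linear T.
  move=> c X Y; rewrite /T scaler_sumr -big_split; apply: eq_bigr => p _ /=.
  by rewrite vecD vecZ scalerDl scalerA.
have T_lambda p : T (lam p) = lam (F p) by exact: (sum_ebase p (fun p => lam (F p))).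
have counit_lin : linear (@kcounit R K) by exact: gcounit_linear.
apply: (lin_eq (f := fun x : kspace K => T (kcoprod x))
  (g := fun x : kspace K => kcounit x *: kone K)).
- by move=> c u v; rewrite KD_coprod_linear T_lin.
- by move=> c u v; rewrite counit_lin scalerDl -scalerA.
move=> g; rewrite -[kcoprod _]/(KD_coprod n a b (lam g)) KD_coprod_lambda.
rewrite -[kcounit _]/(gcounit (lam g)) gcounit_lambda scale1r -[RHS](F_lambda g).
rewrite (lin_sum T_lin); apply: eq_bigr => p _.
rewrite (lin_sum T_lin); apply: eq_bigr => q _.
by rewrite (linZ T_lin) T_lambda.
Qed.

(** On a group element g, the factors of the adjoint of [Omega] end up outside
    and those of [Omega] meet inside: q1 g^-1 (p1 p2) g q2.  The inner sum
    collapses to 1, then g^-1 g cancels, and the outer sum collapses. *)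
Lemma KD_antipode_l (x : kspace K) :
  \sum_p kcoprod x p *: kmul (kantipode (ebase R p.1)) (ebase R p.2) =
  kcounit x *: kone K.
Proof.
rewrite -(@KD_coprod_contract (fun p => p.1^-1 * p.2)%g).
  apply: eq_bigr => p _; congr (_ *: _); rewrite -(gmul_lambda R p.1^-1%g).
  by congr gmul; apply: gantipode_lambda.
move=> g; rewrite exchange_big /=.
transitivity (\sum_q (coef q)^* *: lam (kelt (kadd q.1 q.2))); last first.
  by rewrite (twist_antidiag_conj (fun m => lam (kelt m))) kelt0.
apply: eq_bigr => q _.
transitivity ((coef q)^* *: \sum_p coef p *:
  lam (kelt q.1 * g^-1 * kelt (kadd p.1 p.2) * g * kelt q.2)%g).
  rewrite scaler_sumr; apply: eq_bigr => p _.
  have invE : ((kelt p.1 * g * kelt q.1)^-1 = kelt q.1 * g^-1 * kelt p.1)%g.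
    by rewrite invMg keltV invMg keltV mulgA.
  by rewrite scalerA mulrC invE -keltM !mulgA.
congr (_ *: _).
rewrite (twist_antidiag
  (fun m => lam (kelt q.1 * g^-1 * kelt m * g * kelt q.2)%g)).
by rewrite kelt0 mulg1 mulgKV keltM.
Qed.

Lemma KD_antipode_r (x : kspace K) :
  \sum_p kcoprod x p *: kmul (ebase R p.1) (kantipode (ebase R p.2)) =
  kcounit x *: kone K.
Proof.
rewrite -(@KD_coprod_contract (fun p => p.1 * p.2^-1)%g).
  apply: eq_bigr => p _; congr (_ *: _); rewrite -(gmul_lambda R p.1).
  by congr gmul; apply: gantipode_lambda.
move=> g.
transitivity (\sum_p coef p *: lam (kelt (kadd p.1 p.2))); last first.
  by rewrite (twist_antidiag (fun m => lam (kelt m))) kelt0.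
apply: eq_bigr => p _.
transitivity (coef p *: \sum_q (coef q)^* *:
  lam (kelt p.1 * g * kelt (kadd q.1 q.2) * g^-1 * kelt p.2)%g).
  rewrite scaler_sumr; apply: eq_bigr => q _.
  have invE : ((kelt p.2 * g * kelt q.2)^-1 = kelt q.2 * g^-1 * kelt p.2)%g.
    by rewrite invMg keltV invMg keltV mulgA.
  by rewrite scalerA invE -keltM !mulgA.
congr (_ *: _).
rewrite (twist_antidiag_conj
  (fun m => lam (kelt p.1 * g * kelt m * g^-1 * kelt p.2)%g)).
by rewrite kelt0 mulg1 mulgK keltM.
Qed.

Lemma KD_prekac : is_prekac K.
Proof.
split.
- exact: KD_star_algebra.
- exists (@opnorm R K); apply: opnorm_cstar; first exact: KD_star_algebra.
  exact: gmul_hdot.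
- exact: KD_coprod_linear.
- rewrite KD_coprodE Delta_s_lambda gmulx1 Omega_mul_star.
  exact: (ebase_pair R (1%g, 1%g)).
- move=> x y; rewrite (KD_coprodE x) (KD_coprodE y) (KD_coprodE (kmul x y)).
  have -> : Delta_s (kmul x y) = gmul (Delta_s x) (Delta_s y) by exact: Delta_sM.
  rewrite tmul_gmul.
  exact: gmul_conjugate star_mul_Omega.
- exact: gcounit_linear.
- exact: gcounit_lambda.
- exact: gcounitM.
- exact: gantipode_linear.
- exact: KD_antipode_l.
- exact: KD_antipode_r.
- move=> x; rewrite !KD_coprodE tstar_gstar !gstarM gstarK.
  by rewrite -Delta_s_star gmulA.
- exact: gantipodeM.
Qed.

End Twist.

(** * The self-pairing of KD(n) *)

Section SelfPairing.
Variable R : realType.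
Variables (n : nat) (gT : finGroupType) (a b : gT).
Hypotheses (n_odd : odd n) (dihD : is_dihedral n a b).
Local Notation V := (bool * bool)%type.
Local Notation lam := (lambda R).
Local Notation K := (KD R n a b).
Local Notation dual := (kdual K).
Local Notation zcos := (zcos R n).
Local Notation zsin := (zsin R n).
Local Notation dih := (dih a b).
Local Notation kelt := (kelt n a b).

Let n_gt0 : (0 < n)%N. Proof. exact: odd_gt0. Qed.

(** The default value is never reached, as [dcoordP] shows. *)
Definition dcoord (g : gT) : bool * nat :=
  if [pick p : bool * 'I_(2 * n) | dih p.1 p.2 == g] is Some p
  then (p.1, val p.2) else (false, 0%N).

Lemma dcoordP g : dih (dcoord g).1 (dcoord g).2 = g.
Proof.
rewrite /dcoord; case: pickP => [p /eqP //|no_p].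
have [p _ pK] := dih_ord_bij n_odd dihD.
by have := no_p (p g); rewrite (pK g : dih _ _ = g) eqxx.
Qed.

(** The matrix M of psi in the bases lambda and chi. *)
Definition kdpair (g h : gT) : R[i] :=
  let p := dcoord g in let q := dcoord h in
  kform (p.1, odd p.2) (q.1, odd q.2) (zcos (p.2 * q.2)) (zsin (p.2 * q.2)).

Lemma kdpair_dih s j t k :
  kdpair (dih s j) (dih t k) =
  kform (s, odd j) (t, odd k) (zcos (j * k)) (zsin (j * k)).
Proof.
have coordE s' i : exists2 i', dcoord (dih s' i) = (s', i') & i' = i %[mod 2 * n].
  have /(dih_inj n_odd dihD) [ss' ii'] := dcoordP (dih s' i).
  by exists (dcoord (dih s' i)).2 => //; rewrite [LHS]surjective_pairing ss'.
have odd_mod i i' : i' = i %[mod 2 * n] -> odd i' = odd i.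
  move=> /(congr1 (modn^~ 2)); rewrite !modn_dvdm ?dvdn_mulr //.
  by rewrite !modn2 => /(can_inj oddb).
have [j' Ej jj'] := coordE s j; have [k' Ek kk'] := coordE t k.
rewrite /kdpair Ej Ek (odd_mod _ _ jj') (odd_mod _ _ kk').
have jk : (j' * k' = j * k %[mod n])%N.
  have toN i i' : i' = i %[mod 2 * n] -> i' = i %[mod n].
    by move=> /(congr1 (modn^~ n)); rewrite !modn_dvdm ?dvdn_mull.
  by rewrite -modnMm (toN _ _ jj') (toN _ _ kk') modnMm.
by rewrite (zcos_mod R n_odd jk) (zsin_mod R n_odd jk).
Qed.

Lemma kdpairC g h : kdpair g h = kdpair h g.
Proof.
rewrite -(dcoordP g) -(dcoordP h); move: (dcoord g) (dcoord h) => [s j] [t k].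
by rewrite !kdpair_dih mulnC kformC.
Qed.

(** Klein factors on either side of h change its class by their sum; those on
    the right also invert the rotation part, which only zsin notices. *)
Lemma kdpair_kelt s j t k u v :
  kdpair (dih s j) (kelt u * dih t k * kelt v)%g =
  kform (s, odd j) (kadd (kadd u (t, odd k)) v) (zcos (j * k))
    (flip_sign R v * zsin (j * k)).
Proof.
rewrite /kelt !(dih_mul n_odd dihD) kdpair_dih turnD !turn_mul.
rewrite zcos_shift // zsin_shift // [(n * _ + _)%N]addnC.
rewrite zcos_shift // zsin_shift // -(turn_mul n v.1 j k) zcos_turn // zsin_turn //.
rewrite !oddD !oddM !odd_turn // n_odd !oddb /kadd /=.
by rewrite [(odd k (+) _)]addbC.
Qed.

Lemma kdpair_mul g g' h :
  kdpair (g * g')%g h = \sum_p \sum_q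
    twist_coef R p.1 p.2 * (twist_coef R q.1 q.2)^* *
    (kdpair g (kelt p.1 * h * kelt q.1)%g * kdpair g' (kelt p.2 * h * kelt q.2)%g).
Proof.
rewrite -(dcoordP g) -(dcoordP g') -(dcoordP h).
move: (dcoord g) (dcoord g') (dcoord h) => [s j] [s' j'] [t k] /=.
under eq_bigr do under eq_bigr do rewrite !kdpair_kelt.
rewrite kform_convolution (dih_mul n_odd dihD) kdpair_dih.
rewrite oddD odd_turn // mulnDl -turn_mulr.
by rewrite zcosD // zsinD // !zcos_turn // !zsin_turn // !mulrA.
Qed.

Lemma kdpair_inv g h : kdpair g^-1%g h = (kdpair g h)^*.
Proof.
rewrite -(dcoordP g) -(dcoordP h); move: (dcoord g) (dcoord h) => [s j] [t k] /=.
rewrite (dih_inv n_odd dihD) !kdpair_dih odd_turn //.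
rewrite -turn_mulr zcos_turn // zsin_turn //.
by rewrite kform_conj ?conj_zcos ?conj_zsin.
Qed.

Lemma kdpair_1 h : kdpair 1%g h = 1.
Proof.
rewrite -(dcoordP h); case: (dcoord h) => t k.
have -> : 1%g = dih false 0 by rewrite /dih !expg0 mulg1.
by rewrite kdpair_dih zcos0 zsin0 /kform mulr0 addr0 /kchi mulr1.
Qed.

Lemma dih_eq1 s j : (dih s j == 1%g) = ~~ s && (2 * n %| j)%N.
Proof.
have dih0 : 1%g = dih false 0 by rewrite /dih !expg0 mulg1.
rewrite dih0; apply/eqP/andP => [/(dih_inj n_odd dihD) [-> j0]|[/negPf -> /eqP j0]].
  by rewrite /dvdn j0 mod0n.
by rewrite -(dih_mod dihD) j0.
Qed.

(** As n is odd, k and k + n have opposite parities, while zcos(j k) and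
    zsin(j k) do not change when n is added to k: grouping these two terms
    separates the class of h from its rotation. *)
Lemma sum_dihedral (A : nmodType) (F : gT -> A) :
  \sum_h F h = \sum_(k < n) \sum_t (F (dih t k) + F (dih t (k + n))).
Proof.
rewrite (reindex (@dih_ord n gT a b)) /=; last first.
  exact: onW_bij (dih_ord_bij n_odd dihD).
transitivity (\sum_t \sum_(k < 2 * n) F (dih t k)).
  by rewrite pair_bigA.
rewrite [RHS]exchange_big; apply: eq_bigr => t _ /=.
rewrite -(big_mkord xpredT (fun k => F (dih t k))).
rewrite (@big_cat_nat _ _ _ n) //=; last by rewrite leq_pmull.
rewrite big_split big_mkord; congr (_ + _).
rewrite -{1}[n]add0n big_addn mul2n -addnn addnK big_mkord.
by [].
Qed.

(** Summing over the class of h kills all rows whose class is not trivial,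
    except for a multiple of zsin, and the sum over the rotations kills every
    zsin and all zcos but those at g = 1. *)
Lemma kdpair_sum g : \sum_h kdpair g h = (g == 1%g)%:R * (4 * n)%:R.
Proof.
rewrite -(dcoordP g); case: (dcoord g) => s j /=; rewrite sum_dihedral.
transitivity (\sum_(k < n) \sum_v kform (s, odd j) v (zcos (j * k)) (zsin (j * k))).
  apply: eq_bigr => k _.
  transitivity (\sum_t \sum_e kform (s, odd j) (t, e) (zcos (j * k)) (zsin (j * k))).
    have cosE : zcos (j * (k + n)) = zcos (j * k).
      by rewrite -(zcos_shift R n_odd j k 1) muln1.
    have sinE : zsin (j * (k + n)) = zsin (j * k).
      by rewrite -(zsin_shift R n_odd j k 1) muln1.
    apply: eq_bigr => t _; rewrite !kdpair_dih big_bool /= cosE sinE oddD n_odd.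
    by case: (odd k); rewrite // addrC.
  by rewrite pair_bigA; apply: eq_bigr => -[].
under eq_bigr do rewrite sum_kform -mulr_suml.
rewrite big_split /= -!mulr_sumr sum_zcos // sum_zsin // mulr0 addr0.
rewrite natrM [4 * (_ * _)]mulrCA [LHS]mulrA; congr (_ * _).
rewrite -natrM mulnb dih_eq1; congr (nat_of_bool _)%:R.
case: s => //=; have [j_odd|j_even] := boolP (odd j).
  apply/esym/negP => /(dvdn_trans (dvdn_mulr n (dvdnn 2))).
  by rewrite dvdn2 j_odd.
rewrite -(epsX_eq1 R n_odd) -[zeta R n]/(- eps R n) exprNn -signr_odd.
by rewrite (negPf j_even) mul1r.
Qed.

End SelfPairing.

(** * The self-duality map *)

Section SelfDuality.
Variable R : realType.
Variables (n : nat) (gT : finGroupType) (a b : gT).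
Hypotheses (n_odd : odd n) (dihD : is_dihedral n a b).
Local Notation lam := (lambda R).
Local Notation K := (KD R n a b).
Local Notation dual := (kdual K).
Local Notation kdpair := (kdpair R n a b).
Local Notation dih := (dih a b).
Local Notation eps := (eps R n).
Local Notation zeta := (zeta R n).

Let n_gt0 : (0 < n)%N. Proof. exact: odd_gt0. Qed.

Definition kdpsi (x : kspace K) : kspace dual :=
  \sum_g x g *: ([ffun h => kdpair g h] : vec R gT).

Lemma kdpsiE (x : kspace K) h : kdpsi x h = \sum_g x g * kdpair g h.
Proof.
by rewrite /kdpsi vec_sum; apply: eq_bigr => g _; rewrite vecZ ffunE.
Qed.

Lemma kdpsi_lambda g h : kdpsi (lam g) h = kdpair g h.
Proof.
rewrite kdpsiE -[RHS](sum_delta g (fun g => kdpair g h)).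
by apply: eq_bigr => g' _; rewrite ebaseE.
Qed.

Lemma kdpsi_linear : linear kdpsi.
Proof.
move=> c x y; apply/ffunP => h; rewrite [LHS]kdpsiE vecD vecZ (kdpsiE x h) (kdpsiE y h).
rewrite mulr_sumr -big_split; apply: eq_bigr => g _ /=.
by rewrite vecD vecZ mulrDl mulrA.
Qed.

Lemma kdpsi_sym (x y : kspace K) : pairing (kdpsi x) y = pairing (kdpsi y) x.
Proof.
rewrite /pairing; under eq_bigr do rewrite kdpsiE mulr_suml.
under [RHS]eq_bigr do rewrite kdpsiE mulr_suml.
rewrite exchange_big; apply: eq_bigr => g _; apply: eq_bigr => h _.
by rewrite (kdpairC R n_odd dihD g h) mulrAC -mulrA mulrC.
Qed.

Lemma kdpsiM (x y : kspace K) : kdpsi (kmul x y) = kmul (kdpsi x) (kdpsi y).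
Proof.
have dmulE (f g : kspace dual) h :
  (kmul f g : vec R gT) h = pairing (tensor f g) (KD_coprod n a b (lam h)).
  by rewrite [LHS]ffunE.
have dmul_l (g : kspace dual) : linear (fun f : kspace dual => kmul f g).
  move=> c f f'; apply/ffunP => h; rewrite vecD vecZ !dmulE.
  by rewrite (tensor_linear_l g) pairingDl pairingZl.
have dmul_r (f : kspace dual) : linear (@kmul R dual f).
  move=> c g g'; apply/ffunP => h; rewrite vecD vecZ !dmulE.
  by rewrite (tensor_linear_r f) pairingDl pairingZl.
apply: (lin_eq (f := fun x : kspace K => kdpsi (kmul x y))
  (g := fun x : kspace K => kmul (kdpsi x) (kdpsi y))).
- by move=> c u v; rewrite (kmul_linear_l (KD_star_algebra R n a b)) kdpsi_linear.
- by move=> c u v; rewrite kdpsi_linear dmul_l.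
move=> g; apply: (lin_eq (f := fun y : kspace K => kdpsi (kmul (ebase R g) y))
  (g := fun y : kspace K => kmul (kdpsi (ebase R g)) (kdpsi y))).
- by move=> c u v; rewrite (kmul_linear_r (KD_star_algebra R n a b)) kdpsi_linear.
- by move=> c u v; rewrite kdpsi_linear dmul_r.
move=> g'; apply/ffunP => h; rewrite dmulE.
rewrite -[kmul _ _]/(gmul (lam g) (lam g')) gmul_lambda kdpsi_lambda.
rewrite (KD_coprod_lambda R n_odd dihD) (kdpair_mul R n_odd dihD) pairing_sumr.
apply: eq_bigr => p _; rewrite pairing_sumr; apply: eq_bigr => q _.
rewrite pairingZr; congr (_ * _).
rewrite pairing_ebase tensorE; congr (_ * _); exact/esym/kdpsi_lambda.
Qed.

Lemma kdpsi_one : kdpsi (kone K) = kone dual.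
Proof.
apply/ffunP => h; rewrite [RHS]ffunE [LHS]kdpsi_lambda (kdpair_1 R n_odd dihD).
by rewrite -[RHS]/(gcounit (lam h)) gcounit_lambda.
Qed.

Lemma kdpsi_star (x : kspace K) : kdpsi (kstar x) = kstar (kdpsi x).
Proof.
apply/ffunP => h; rewrite [RHS]ffunE.
have -> : kstar (kantipode (ebase R h : kspace K)) = lam h.
  rewrite -[LHS]/(gstar (gantipode (lam h))) gantipode_lambda gstar_lambda.
  by rewrite invgK.
rewrite pairing_ebase !kdpsiE rmorph_sum (reindex_inj invg_inj).
apply: eq_bigr => g _ /=.
by rewrite rmorphM gstarE invgK (kdpair_inv R n_odd dihD).
Qed.

(** The sum of all group elements is an integral of KD(n): a form of the shape
    psi(y) takes there 4 n times the coordinate of y at 1.  With y = g^-1 x this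
    recovers every coordinate of x from psi. *)
Lemma kdpsi_coord (x : kspace K) (g : gT) :
  \sum_h kdpsi (@kmul R K (lam g^-1%g) x) h = (4 * n)%:R * x g.
Proof.
have lambda_mul : gmul (lam g^-1%g) x 1%g = x g.
  rewrite gmulE -[RHS](sum_delta g (fun h => x h)) (reindex_inj invg_inj) /=.
  by apply: eq_bigr => h _; rewrite ebaseE (inj_eq invg_inj) invgK mulg1.
under eq_bigr do rewrite kdpsiE.
rewrite exchange_big /=.
under eq_bigr do rewrite -mulr_sumr (kdpair_sum R n_odd dihD) mulrCA.
rewrite (sum_delta (1%g : gT) (fun h => gmul (lam g^-1%g) x h * (4 * n)%:R)).
by rewrite mulrC lambda_mul.
Qed.

Lemma kdpsi_inj (x : kspace K) : kdpsi x = 0 -> x = 0.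
Proof.
move=> x0; apply/ffunP => g; rewrite [RHS]ffunE.
have dmul0 (f : kspace dual) : kmul f 0 = 0 :> kspace dual.
  by apply/ffunP => h; rewrite ffunE (lin0 (tensor_linear_r f)) [RHS]ffunE
    (lin0 (pairing_linear_l _)).
have := kdpsi_coord x g; rewrite kdpsiM x0 dmul0 big1 => [/esym/eqP|h _]; last first.
  by rewrite ffunE.
by rewrite mulf_eq0 pnatr_eq0 muln_eq0 (negPf (lt0n_neq0 n_gt0)) => /eqP.
Qed.

Lemma kdpsi_bij : bijective kdpsi.
Proof.
pose F : {linear vec R gT -> vec R gT} := HB.pack kdpsi
  (GRing.isLinear.Build R[i] (vec R gT) (vec R gT) *:%R kdpsi kdpsi_linear).
have FE x : linfun F x = kdpsi x by rewrite lfunE.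
have kerF : lker (linfun F) == 0%VS.
  rewrite -subv0; apply/subvP => x; rewrite memv_ker FE => /eqP x0.
  by rewrite memv0 (kdpsi_inj x0).
exists (linfun F)^-1%VF => x.
  by rewrite -FE lker0_lfunK.
by rewrite -FE lker0_lfunVK.
Qed.

Lemma hatE (x : vec R gT) : hat n a b x = x.
Proof. exact/esym/vec_expand. Qed.

Lemma fourier_coord (c : nat -> R[i]) s t (k : 'I_(2 * n)) :
  (\sum_(i < 2 * n) c i *: lam (dih s i)) (dih t k) = (t == s)%:R * c k.
Proof.
rewrite vec_sum -(sum_delta k (fun i : 'I__ => (t == s)%:R * c i)).
apply: eq_bigr => i _; rewrite vecZ ebaseE mulrC mulrA -natrM mulnb.
congr (_%:R * _); congr nat_of_bool.
rewrite -[dih t k]/(dih_ord a b (t, k)) -[dih s i]/(dih_ord a b (s, i)).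
by rewrite (inj_eq (bij_inj (dih_ord_bij n_odd dihD))) xpair_eqE andbC eq_sym.
Qed.

Lemma fourier_rot (c : nat -> R[i]) t (k : 'I_(2 * n)) :
  (\sum_(i < 2 * n) c i *: lam (a ^+ i)%g) (dih t k) = (~~ t)%:R * c k.
Proof.
have aE i : (a ^+ i)%g = dih false i by rewrite /dih expg0 mul1g.
under eq_bigr do rewrite aE.
by rewrite (fourier_coord c false t k) eqbF_neg.
Qed.

Lemma fourier_refl (c : nat -> R[i]) t (k : 'I_(2 * n)) :
  (\sum_(i < 2 * n) c i *: lam (b * a ^+ i)%g) (dih t k) = t%:R * c k.
Proof. by rewrite -[t in RHS]eqb_id -(fourier_coord c true t k). Qed.

Lemma eps_zeta k : eps ^+ k = (-1) ^+ k * zeta ^+ k.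
Proof. by rewrite -exprMn mulN1r opprK. Qed.

Lemma eq_on_dih (x y : vec R gT) :
  (forall t (k : 'I_(2 * n)), x (dih t k) = y (dih t k)) -> x = y.
Proof.
move=> xy; apply/ffunP => h; have [p _ pK] := dih_ord_bij n_odd dihD.
by rewrite -(pK h); apply: xy.
Qed.

Lemma kdpsi_a :
  kdpsi (lam a) =
    n%:R *: (2 *: hat n a b (e11 R n a (n%:Z - 1))
             + hat n a b (e22 R n a 1)
             - (hat n a b (e11 R n a 1)
                + hat n a b (e12 R n a b (n%:Z - 1))
                + hat n a b (e21 R n a b (n%:Z - 1)))).
Proof.
(* For n odd, the matrix units of index n - 1 are Fourier sums in zeta. *)
have epsn1 : eps ^ (n%:Z - 1) = zeta^-1.
  by rewrite expfzDr ?eps_neq0 // -exprnP epsXn // mulN1r -invrN.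
have eps_p k : eps ^ ((n%:Z - 1) * k%:Z) = zeta ^- k.
  by rewrite -exprz_exp epsn1 -exprnP exprVn.
have eps_m k : eps ^ (- ((n%:Z - 1) * k%:Z)) = zeta ^+ k.
  by rewrite -invr_expz eps_p invrK.
have eps1_p k : eps ^ (1 * k%:Z) = (-1) ^+ k * zeta ^+ k.
  by rewrite mul1r -exprnP eps_zeta.
have eps1_m k : eps ^ (- (1 * k%:Z)) = (-1) ^+ k * zeta ^- k.
  by rewrite -invr_expz eps1_p invfM -exprVn invrN1.
transitivity (n%:R *: (2 *: e11 R n a (n%:Z - 1) + e22 R n a 1 -
    (e11 R n a 1 + e12 R n a b (n%:Z - 1) + e21 R n a b (n%:Z - 1)))); last first.
  by congr (_ *: (_ *: _ + _ - (_ + _ + _))); apply/esym/hatE.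
apply: eq_on_dih => t k.
have -> : lam a = lam (dih false 1) by rewrite /dih expg0 mul1g expg1.
rewrite kdpsi_lambda (kdpair_dih R n_odd dihD) mul1n.
have coordE (u v w x y : vec R gT) h :
    (n%:R *: (2 *: u + v - (w + x + y))) h =
    n%:R * (2 * u h + v h - (w h + x h + y h)).
  have vecN (z : vec R gT) : (- z) h = - z h by rewrite ffunE.
  by rewrite vecZ vecD vecN !vecD vecZ.
have e11E j : e11 R n a j (dih t k) =
    (2 * n)%:R^-1 * ((~~ t)%:R * eps ^ (- (j * k%:Z))).
  by rewrite [LHS]vecZ (fourier_rot (fun i => eps ^ (- (j * i%:Z)))).
have e22E j : e22 R n a j (dih t k) =
    (2 * n)%:R^-1 * ((~~ t)%:R * eps ^ (j * k%:Z)).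
  by rewrite [LHS]vecZ (fourier_rot (fun i => eps ^ (j * i%:Z))).
have e12E j : e12 R n a b j (dih t k) =
    (2 * n)%:R^-1 * (t%:R * eps ^ (j * k%:Z)).
  by rewrite [LHS]vecZ (fourier_refl (fun i => eps ^ (j * i%:Z))).
have e21E j : e21 R n a b j (dih t k) =
    (2 * n)%:R^-1 * (t%:R * eps ^ (- (j * k%:Z))).
  by rewrite [LHS]vecZ (fourier_refl (fun i => eps ^ (- (j * i%:Z)))).
transitivity (n%:R * (2 * ((2 * n)%:R^-1 * ((~~ t)%:R * zeta ^+ k)) +
    (2 * n)%:R^-1 * ((~~ t)%:R * ((-1) ^+ k * zeta ^+ k)) -
    ((2 * n)%:R^-1 * ((~~ t)%:R * ((-1) ^+ k * zeta ^- k)) +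
     (2 * n)%:R^-1 * (t%:R * zeta ^- k) + (2 * n)%:R^-1 * (t%:R * zeta ^+ k)))).
  have n_neq0 : n%:R != 0 :> R[i] by rewrite pnatr_eq0 -lt0n.
  have zk_neq0 : zeta ^+ k != 0 by rewrite expf_neq0 ?zeta_neq0.
  rewrite natrM /kform /kchi /ksigma /zcos /zsin /= -(signr_odd _ k).
  case: (t); case: (odd k) => /=; field; by rewrite n_neq0 zk_neq0.
rewrite coordE; congr (_ * (_ * _ + _ - (_ + _ + _))).
- by rewrite e11E eps_m.
- by rewrite e22E eps1_p.
- by rewrite e11E eps1_m.
- by rewrite e12E eps_p.
- by rewrite e21E eps_m.
Qed.

Lemma kdpsi_b : kdpsi (lam b) = (4 * n)%:R *: hat n a b (e4 R n a b).
Proof.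
transitivity ((4 * n)%:R *: e4 R n a b); last by congr (_ *: _); apply/esym/hatE.
apply: eq_on_dih => t k.
have -> : lam b = lam (dih true 0) by rewrite /dih expg1 expg0 mulg1.
rewrite kdpsi_lambda (kdpair_dih R n_odd dihD) mul0n.
have n_neq0 : (4 * n)%:R != 0 :> R[i] by rewrite pnatr_eq0 muln_eq0 -lt0n n_gt0.
rewrite vecZ [e4 _ _ _ _ _]vecZ mulVKf //.
transitivity ((\sum_(i < 2 * n) (-1) ^+ i *: lam (a ^+ i)%g +
    \sum_(i < 2 * n) (-1) ^+ i *: lam (b * a ^+ i)%g) (dih t k)); last first.
  congr (fun_of_fin _ _); rewrite -big_split; apply: eq_bigr => i _ /=.
  by rewrite scalerDr.
transitivity ((~~ t)%:R * (-1) ^+ k + t%:R * (-1) ^+ k : R[i]); last first.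
  rewrite vecD; congr (_ + _); first exact/esym/(fourier_rot (fun i => (-1) ^+ i)).
  exact/esym/(fourier_refl (fun i => (-1) ^+ i)).
rewrite zcos0 zsin0 /kform mulr0 addr0 /kchi /= -(signr_odd _ k).
by case: t; case: (odd k) => /=; ring.
Qed.

End SelfDuality.

Theorem theorem6p1 (R : realType) (n : nat) (gT : finGroupType) (a b : gT)
    (hn : odd n) (hD : is_dihedral n a b) :
  [/\ is_kac_algebra (KD R n a b),
      is_kac_algebra (kdual (KD R n a b)),
      self_dual (KD R n a b) &
      exists psi : kspace (KD R n a b) -> kspace (kdual (KD R n a b)),
        [/\ is_kac_iso psi,
            psi (lambda R a) =
              n%:R *: (2 *: hat n a b (e11 R n a (n%:Z - 1))
                       + hat n a b (e22 R n a 1)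
                       - (hat n a b (e11 R n a 1)
                          + hat n a b (e12 R n a b (n%:Z - 1))
                          + hat n a b (e21 R n a b (n%:Z - 1)))) &
            psi (lambda R b) = (4 * n)%:R *: hat n a b (e4 R n a b)]].
Proof.
have preK := KD_prekac R hn hD.
have psi_lin := @kdpsi_linear R n gT a b.
have psi_bij := kdpsi_bij R hn hD.
have psi_sym := @kdpsi_sym R n gT a b hn hD.
have psiM := @kdpsiM R n gT a b hn hD.
have psi1 := kdpsi_one R hn hD.
have psi_star := @kdpsi_star R n gT a b hn hD.
have isoK := symmetric_prekac_iso preK psi_lin psi_bij psi_sym psiM psi1 psi_star.
split.
- exact: prekac_kac preK psi_lin psi_bij psiM psi1 psi_star.
- exact: prekac_kac_dual preK psi_lin psi_bij psiM psi1 psi_star.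
- by exists (@kdpsi R n gT a b).
- exists (@kdpsi R n gT a b); split=> //.
    exact: kdpsi_a.
  exact: kdpsi_b.
Qed.
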